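(* Let $(H,R)$ be a (finite dimensional) semisimple factorizable Hopf algebra over an algebraically closed field $k$. Then for any simple left $H$-modules $W$ and $M$, $\overline{W\otimes M}$ is an irreducible object of ${}_H^H\mathcal{YD}$. Conversely, every irreducible Yetter-Drinfeld module in ${}_H^H\mathcal{YD}$ is isomorphic to $\overline{W\otimes M}$ for some $(W,M)\in\operatorname{Irr}(H)\times\operatorname{Irr}(H)$. Furthermore, any irreducible Yetter-Drinfeld submodule $D$ of $H=(H,\cdot_{ad},\Delta)\in{}_H^H\mathcal{YD}$ is of the form $\overline{W\otimes W^*}$ (i.e. isomorphic to it in ${}_H^H\mathcal{YD}$) for some $W\in\operatorname{Irr}(H)$, and in this case $D_W=D$.
   Context: Notation: $\Delta(h)=h_{(1)}\otimes h_{(2)}$ is the coproduct and $S$ the antipode of $H$; $R=R^1\otimes R^2$ (summation understood) is the universal $R$-matrix, and $R_1=R_1{}^1\otimes R_1{}^2$, $R_2=R_2{}^1\otimes R_2{}^2$ denote two copies of $R$. The convention is $(\Delta\otimes\mathrm{id})R=R_{13}R_{23}$, $(\mathrm{id}\otimes\Delta)R=R_{13}R_{12}$, $R\Delta(h)=\Delta^{op}(h)R$. A finite dimensional quasi-triangular Hopf algebra $(H,R)$ is factorizable if the linear map $H^*\to H$, $p\mapsto\langle p,R_1{}^2R_2{}^1\rangle R_1{}^1R_2{}^2$ is bijective. The left adjoint action is $h\cdot_{ad}h'=h_{(1)}h'S(h_{(2)})$. $\operatorname{Irr}(H)$ is a set of representatives of isomorphism classes of irreducible left $H$-modules. ${}_H^H\mathcal{YD}$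 is the category of left-left Yetter-Drinfeld modules: left $H$-modules and left $H$-comodules $V$ with $h_{(1)}v_{\langle -1\rangle}\otimes h_{(2)}v_{\langle 0\rangle}=(h_{(1)}v)_{\langle -1\rangle}h_{(2)}\otimes(h_{(1)}v)_{\langle 0\rangle}$. $H$ with action $\cdot_{ad}$ and coaction $\Delta$ is an object of ${}_H^H\mathcal{YD}$. Transmuted braided group: $H_R$ is the algebra $H$ with the left $H$-action $\cdot_{ad}$ and the coproduct $\Delta_R(h)=h_{(1)}S(R^2)\otimes R^1\cdot_{ad}h_{(2)}$ (counit that of $H$); it is a Hopf algebra in the braided category of finite dimensional left $H$-modules. ${}_H^{H_R}\mathcal{M}$ is the category of left $H$-modules $V$ with a left $(H,\Delta_R)$-coaction $\rho_R(v)=v^{\langle -1\rangle}\otimes v^{\langle 0\rangle}$ such that $\rho_R(hv)=h_{(1)}\cdot_{ad}v^{\langle -1\rangle}\otimes h_{(2)}v^{\langle 0\rangle}$. There is an isomorphism of categories ${}_H^H\mathcal{YD}\cong{}_H^{H_R}\mathcal{M}$ which keeps the $H$-action and sends a Yetter-Drinfeld coaction $v\mapsto v_{\langle -1\rangle}\otimes v_{\langle 0\rangle}$ to $\rho_R(v)=v_{\langle -1\rangle}S(R^2)\otimes R^1v_{\langle 0\rangle}$; the inverse sends $\rho_R(v)=v^{\langle -1\rangle}\otimes v^{\langle 0\rangle}$ to the coaction $v\mapsto v^{\langle -1\rangle}R^2\otimes R^1v^{\langle 0\rangle}$. Objects of the two categories are identified in this way. For left $H$-modules $W,M$, $\overline{W\otimes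 M}\in{}_H^{H_R}\mathcal{M}$ is $W\otimes M$ with $h(w\otimes m)=h_{(1)}w\otimes h_{(2)}m$ and $\rho_R(w\otimes m)=S(R_2{}^2R_1{}^1)\otimes R_2{}^1R_1{}^2w\otimes m$; it is viewed as a Yetter-Drinfeld module through the isomorphism of categories ${}_H^{H_R}\mathcal{M}\cong{}_H^H\mathcal{YD}$ which keeps the $H$-action and sends $\rho_R(v)=v^{\langle -1\rangle}\otimes v^{\langle 0\rangle}$ to the coaction $v\mapsto v^{\langle -1\rangle}R^2\otimes R^1v^{\langle 0\rangle}$. $W^*$ is the left $H$-module with $\langle hw^*,w\rangle=\langle w^*,S^{-1}(h)w\rangle$. Finally $D_W=\operatorname{span}\{S(R_2{}^2R_1{}^1)\langle w^*,R_2{}^1R_1{}^2w\rangle\mid w\in W,\ w^*\in W^*\}\subseteq H$. *)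

(* Defs.v *)
From HB Require Import structures.
From mathcomp Require Import all_boot all_order all_algebra all_field.
From mathcomp Require Import boolp functions.
Set Implicit Arguments.
Unset Strict Implicit.
Unset Printing Implicit Defensive.
Import GRing.Theory.
Local Open Scope ring_scope.
Local Open Scope quotient_scope.

(* Tensor product of two arbitrary vector spaces: finite formal sums of pairs,
   two sums being identified when every bilinear map agrees on them. *)
Section Tensor.
Variables (k : fieldType) (V W : lmodType k).

Definition bilinear_map (U : lmodType k) (f : V -> W -> U) : Prop :=
  inhabited (bilinear_for *:%R *:%R f).

Definition formal_sum (U : lmodType k) (f : V -> W -> U) (s : seq (V * W)) : U :=
  \sum_(x <- s) f x.1 x.2.

Definition tensor_eqv : rel (seq (V * W)) := fun s t =>
  `[< forall (U : lmodType k) (f : V -> W -> U),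
        bilinear_map f -> formal_sum f s = formal_sum f t >].

Lemma tensor_eqv_class : equiv_class_of tensor_eqv.
Proof.
split=> [s|s t|t s u].
- exact/asboolP.
- by apply/asboolP/asboolP => e U f bf; rewrite e.
- by move=> /asboolP e1 /asboolP e2; apply/asboolP => U f bf; rewrite e1 ?e2.
Qed.

Canonical tensor_equiv := EquivRelPack tensor_eqv_class.

Definition tensor := {eq_quot tensor_equiv}.
HB.instance Definition _ := Choice.on tensor.
HB.instance Definition _ := EqQuotient.on tensor.

Definition pure (v : V) (w : W) : tensor := \pi_tensor [:: (v, w)].

(* [tlift f t] only depends on [t], and not on the chosen representative, when
   [f] is bilinear; this is the only case in which it is used. *)
Definition tlift (U : lmodType k) (f : V -> W -> U) (t : tensor) : U :=
  formal_sum f (repr t).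

Lemma tlift_pi (U : lmodType k) (f : V -> W -> U) s :
  bilinear_map f -> tlift f (\pi_tensor s) = formal_sum f s.
Proof.
move=> bf; rewrite /tlift.
have /eqmodP/asboolP : repr (\pi_tensor s) = s %[mod tensor] by rewrite reprK.
exact.
Qed.

Lemma tlift_pure (U : lmodType k) (f : V -> W -> U) v w :
  bilinear_map f -> tlift f (pure v w) = f v w.
Proof. by move=> bf; rewrite tlift_pi // /formal_sum big_seq1. Qed.

Lemma tensor_ext (s t : tensor) :
  (forall (U : lmodType k) (f : V -> W -> U),
     bilinear_map f -> tlift f s = tlift f t) -> s = t.
Proof.
by move=> e; rewrite -[s]reprK -[t]reprK; apply/eqmodP/asboolP => U f /e.
Qed.

Definition tzero : tensor := \pi_tensor [::].
Definition tadd (s t : tensor) : tensor := \pi_tensor (repr s ++ repr t).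
Definition tscale (a : k) (t : tensor) : tensor :=
  \pi_tensor [seq (a *: x.1, x.2) | x <- repr t].
Definition topp (t : tensor) : tensor := tscale (-1) t.

Section LiftFor.
Variables (U : lmodType k) (f : V -> W -> U) (bf : bilinear_map f).

Lemma tlift0 : tlift f tzero = 0.
Proof. by rewrite tlift_pi // /formal_sum big_nil. Qed.

Lemma tliftD s t : tlift f (tadd s t) = tlift f s + tlift f t.
Proof. by rewrite tlift_pi // /formal_sum big_cat. Qed.

Lemma bilinear_scalel a v w : f (a *: v) w = a *: f v w.
Proof.
case: bf => -[fl _].
have f0 : f 0 w = 0.
  by have /= := fl w (-1) 0 0; rewrite scaler0 addr0 scaleN1r addNr.
by have /= := fl w a v 0; rewrite !addr0 f0 addr0.
Qed.

Lemma tliftZ a t : tlift f (tscale a t) = a *: tlift f t.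
Proof.
rewrite tlift_pi // /formal_sum big_map scaler_sumr.
by apply: eq_bigr => x _; rewrite bilinear_scalel.
Qed.

End LiftFor.

Lemma taddA : associative tadd.
Proof. by move=> s t u; apply: tensor_ext => U f bf; rewrite !tliftD ?addrA. Qed.
Lemma taddC : commutative tadd.
Proof. by move=> s t; apply: tensor_ext => U f bf; rewrite !tliftD // addrC. Qed.
Lemma tadd0 : left_id tzero tadd.
Proof.
by move=> s; apply: tensor_ext => U f bf; rewrite tliftD ?tlift0 ?add0r.
Qed.
Lemma taddN : left_inverse tzero topp tadd.
Proof.
move=> s; apply: tensor_ext => U f bf.
by rewrite tliftD ?tlift0 ?tliftZ ?scaleN1r ?addNr.
Qed.
HB.instance Definition _ := GRing.isZmodule.Build tensor taddA taddC tadd0 taddN.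

Lemma tscaleA a b t : tscale a (tscale b t) = tscale (a * b) t.
Proof. by apply: tensor_ext => U f bf; rewrite !tliftZ // scalerA. Qed.
Lemma tscale1 : left_id 1 tscale.
Proof. by move=> t; apply: tensor_ext => U f bf; rewrite tliftZ ?scale1r. Qed.
Lemma tscaleDr : right_distributive tscale +%R.
Proof.
move=> a s t; apply: tensor_ext => U f bf.
by rewrite !(tliftZ, tliftD) // scalerDr.
Qed.
Lemma tscaleDl t : {morph tscale^~ t : a b / a + b}.
Proof.
move=> a b; apply: tensor_ext => U f bf.
by rewrite !(tliftZ, tliftD) // scalerDl.
Qed.
HB.instance Definition _ :=
  GRing.Zmodule_isLmodule.Build k tensor tscaleA tscale1 tscaleDr tscaleDl.

Lemma tlift_linear (U : lmodType k) (f : V -> W -> U) :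
  bilinear_map f -> linear (tlift f).
Proof.
by move=> bf a s t; rewrite [LHS](tliftD bf) [X in X + _](tliftZ bf).
Qed.

Lemma pure_bilinear : bilinear_map pure.
Proof.
split; split=> [w a v v'|v a w w'] /=; apply: tensor_ext => U f bf.
  rewrite tlift_linear ?tlift_pure //; case: bf => -[fl _]; exact: fl.
rewrite tlift_linear ?tlift_pure //; case: bf => -[_ fr]; exact: fr.
Qed.

End Tensor.

Notation "V ⊗ W" := (tensor V W) (at level 40, left associativity) : type_scope.
Notation "v ⊗ w" := (pure v w) (at level 40, left associativity) : ring_scope.

(* Sweedler summation: with t = t' ⊗ t'' (summation understood), this is the
   value at t of the linear map induced by the bilinear map (a, b) |-> F. *)
Notation "\tsum_ ( a , b <- t ) F" := (tlift (fun a b => F) t)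
  (at level 41, F at level 41, a name, b name, t at level 200,
   format "\tsum_ ( a ,  b  <-  t )  F") : ring_scope.

Section Dual.
Variables (k : fieldType) (V : lmodType k).

Definition linear_form : {pred V -> k^o} := fun f => `[< linear f >].

Lemma linear_form_submod : submod_closed linear_form.
Proof.
split=> [|a f g /asboolP lf /asboolP lg]; apply/asboolP => b u v.
  by rewrite -[LHS]/(0 : k^o) -[RHS]/(b *: 0 + 0 : k^o) scaler0 addr0.
rewrite -[LHS]/(a *: f (b *: u + v) + g (b *: u + v)).
rewrite -[RHS]/(b *: (a *: f u + g u) + (a *: f v + g v)).
by rewrite lf lg !scalerDr addrACA !scalerA mulrC.
Qed.

HB.instance Definition _ :=
  GRing.isSubmodClosed.Build k (V -> k^o) linear_form linear_form_submod.

Record dual := Dual { dual_fun :> V -> k^o; _ : dual_fun \in linear_form }.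
HB.instance Definition _ := [isSub for dual_fun].
HB.instance Definition _ := [Choice of dual by <:].
HB.instance Definition _ := [SubChoice_isSubLmodule of dual by <:].

End Dual.

Section HopfAlgebra.
Variables (k : fieldType) (H : falgType k).

Definition tmul (s t : H ⊗ H) : H ⊗ H :=
  \tsum_(a, b <- s) \tsum_(c, d <- t) (a * c) ⊗ (b * d).

Definition tswap (t : H ⊗ H) : H ⊗ H := \tsum_(a, b <- t) b ⊗ a.

(* Threefold tensors are taken in H ⊗ (H ⊗ H). *)
Record hopf_algebra := HopfAlgebra {
  coprod : {linear H -> (H ⊗ H)%type};
  counit : {linear H -> k^o};
  antipode : 'End(H);
  coprodA : forall h,
    \tsum_(a, b <- coprod h) \tsum_(a1, a2 <- coprod a) a1 ⊗ (a2 ⊗ b) =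
    \tsum_(a, b <- coprod h) a ⊗ coprod b;
  counitl : forall h, \tsum_(a, b <- coprod h) (counit a *: b) = h;
  counitr : forall h, \tsum_(a, b <- coprod h) (counit b *: a) = h;
  coprod1 : coprod 1 = 1 ⊗ 1;
  coprodM : forall g h, coprod (g * h) = tmul (coprod g) (coprod h);
  counit1 : counit 1 = 1;
  counitM : forall g h, counit (g * h) = counit g * counit h;
  antipodel : forall h, \tsum_(a, b <- coprod h) (antipode a * b) = (counit h)%:A;
  antipoder : forall h, \tsum_(a, b <- coprod h) (a * antipode b) = (counit h)%:A
}.

Definition semisimple : Prop :=
  forall I : {vspace H}, (fullv * I <= I)%VS ->
  exists J : {vspace H},
    [/\ (fullv * J <= J)%VS, (I + J)%VS = fullv & (I :&: J)%VS = 0%VS].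

End HopfAlgebra.

Section QuasiTriangular.
Variables (k : fieldType) (H : falgType k) (A : hopf_algebra H) (R : H ⊗ H).
Local Notation Δ := (coprod A).
Local Notation S := (antipode A).

Record quasi_triangular : Prop := QuasiTriangular {
  Rmatrix_inv : exists R', tmul R R' = 1 ⊗ 1 /\ tmul R' R = 1 ⊗ 1;
  (* (Δ ⊗ id) R = R13 R23 *)
  Rmatrix_coprodl :
    \tsum_(x, y <- R) \tsum_(x1, x2 <- Δ x) x1 ⊗ (x2 ⊗ y) =
    \tsum_(a, b <- R) \tsum_(c, d <- R) a ⊗ (c ⊗ (b * d));
  (* (id ⊗ Δ) R = R13 R12 *)
  Rmatrix_coprodr :
    \tsum_(x, y <- R) x ⊗ Δ y =
    \tsum_(a, b <- R) \tsum_(c, d <- R) (a * c) ⊗ (d ⊗ b);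
  Rmatrix_intertwine : forall h, tmul R (Δ h) = tmul (tswap (Δ h)) R
}.

Definition drinfeld_map (p : dual H) : H :=
  \tsum_(a, b <- R) \tsum_(c, d <- R) ((p (b * c) : k) *: (a * d)).

Definition factorizable : Prop := bijective drinfeld_map.

Lemma adjoint_linear h : linear (fun x : H => \tsum_(a, b <- Δ h) (a * x * S b)).
Proof.
move=> c x y; rewrite /tlift /formal_sum scaler_sumr -big_split /=.
by apply: eq_bigr => -[a b] _ /=; rewrite mulrDr mulrDl -scalerAr -scalerAl.
Qed.

Definition adjoint (h : H) (x : H) : H := \tsum_(a, b <- Δ h) (a * x * S b).
HB.instance Definition _ h :=
  GRing.isLinear.Build k H H *:%R (adjoint h) (adjoint_linear h).

(* The data of an H-module and of a Yetter-Drinfeld module; the axioms are the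
   predicates [is_module] and [is_yd] below. *)
Record module_data := ModuleData {
  mod_car :> lmodType k;
  act : H -> {linear mod_car -> mod_car}
}.

Record yd_data := YDData {
  yd_mod :> module_data;
  coact : yd_mod -> H ⊗ yd_mod
}.

Record is_module (V : module_data) : Prop := IsModule {
  act_linear : forall v : V, linear (fun h => act V h v);
  act1 : forall v : V, act V 1 v = v;
  actM : forall g h (v : V), act V (g * h) v = act V g (act V h v)
}.

Definition stable (V : module_data) (U : {pred V}) : Prop :=
  submod_closed U /\ forall h u, u \in U -> act V h u \in U.

Definition simple_module (V : module_data) : Prop :=
  [/\ is_module V,
      exists v : V, v != 0
    & forall U : {pred V}, stable U ->
        (forall v, v \in U -> v = 0) \/ (forall v, v \in U)].

Definition module_iso (V W : module_data) : Prop :=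
  exists f : {linear V -> W},
    bijective f /\ forall h v, f (act V h v) = act W h (f v).

Record is_Irr (I : Type) (irr : I -> module_data) : Prop := IsIrr {
  Irr_simple : forall i, simple_module (irr i);
  Irr_all : forall V, simple_module V -> exists i, module_iso V (irr i);
  Irr_distinct : forall i j, module_iso (irr i) (irr j) -> i = j
}.

Record is_yd (V : yd_data) : Prop := IsYD {
  yd_module : is_module V;
  coact_linear : linear (@coact V);
  coactA : forall v : V,
    \tsum_(x, u <- coact v) \tsum_(x1, x2 <- Δ x) x1 ⊗ (x2 ⊗ u) =
    \tsum_(x, u <- coact v) x ⊗ coact u;
  coact_counit : forall v : V, \tsum_(x, u <- coact v) (counit A x *: u) = v;
  yd_compat : forall h (v : V),
    \tsum_(h1, h2 <- Δ h) \tsum_(x, u <- coact v) (h1 * x) ⊗ act V h2 u =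
    \tsum_(h1, h2 <- Δ h) \tsum_(x, u <- coact (act V h1 v)) (x * h2) ⊗ u
}.

(* The last clause says that the coaction maps U into H ⊗ U. *)
Definition yd_submodule (V : yd_data) (U : {pred V}) : Prop :=
  stable U /\
  forall u, u \in U -> exists2 s : seq (H * V),
    all (fun x => x.2 \in U) s & coact u = \sum_(x <- s) x.1 ⊗ x.2.

Definition irreducible_yd (V : yd_data) : Prop :=
  [/\ is_yd V,
      exists v : V, v != 0
    & forall U : {pred V}, yd_submodule U ->
        (forall v, v \in U -> v = 0) \/ (forall v, v \in U)].

Definition yd_iso (V W : yd_data) : Prop :=
  exists f : {linear V -> W},
    [/\ bijective f,
        forall h v, f (act V h v) = act W h (f v)
      & forall v, coact (f v) = \tsum_(x, u <- coact v) x ⊗ f u].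

Definition yd_regular : yd_data := @YDData (ModuleData adjoint) Δ.

(* A subspace D of H, with the action and coaction of [yd_regular] followed by
   the projection onto D. When D is a Yetter-Drinfeld submodule of H, these are
   the restricted action and coaction. *)
Definition yd_sub (D : {vspace H}) : yd_data :=
  @YDData (ModuleData (fun h => vsproj D \o adjoint h \o vsval : {linear _ -> _}))
    (fun d : subvs_of D => \tsum_(x, y <- Δ (vsval d)) x ⊗ vsproj D y).

Section TensorModule.
Variables W M : module_data.

Definition tensor_act (h : H) (t : W ⊗ M) : W ⊗ M :=
  \tsum_(h1, h2 <- Δ h) \tsum_(w, m <- t) act W h1 w ⊗ act M h2 m.

Lemma tensor_act_linear h : linear (tensor_act h).
Proof.
move=> c s t; rewrite /tensor_act {1 3 5}/tlift /formal_sum scaler_sumr -big_split.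
apply: eq_bigr => -[h1 h2] _ /=; apply: tlift_linear.
case: (pure_bilinear W M) => -[pl pr].
split; split=> [m a w w'|w a m m'] /=; rewrite linearP; [exact: pl | exact: pr].
Qed.

HB.instance Definition _ h :=
  GRing.isLinear.Build k (W ⊗ M)%type (W ⊗ M)%type *:%R (tensor_act h)
    (tensor_act_linear h).

Definition tensor_module : module_data := @ModuleData (W ⊗ M)%type tensor_act.

(* ρ_R (w ⊗ m) = S(R2'' R1') ⊗ R2' R1'' w ⊗ m, where R1 = a ⊗ b, R2 = c ⊗ d *)
Definition bar_coactR (t : tensor_module) : H ⊗ tensor_module :=
  \tsum_(w, m <- t) \tsum_(a, b <- R) \tsum_(c, d <- R)
    S (d * a) ⊗ ((act W (c * b) w ⊗ m) : tensor_module).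

(* the Yetter-Drinfeld coaction corresponding to ρ_R under the isomorphism of
   categories between (H_R)-comodules in H-modules and Yetter-Drinfeld modules *)
Definition bar_tensor : yd_data :=
  @YDData tensor_module (fun t =>
    \tsum_(x, u <- bar_coactR t) \tsum_(a, b <- R)
      (x * b) ⊗ act tensor_module a u).

End TensorModule.

Section DualModule.
Variable W : module_data.

(* The antipode of a finite dimensional Hopf algebra is bijective, so that its
   inverse as a linear endomorphism is a two-sided inverse. *)
Definition antipode_inv : H -> H := (S^-1)%VF.

Lemma dual_act_subproof h (f : dual W) :
  (fun w => f (act W (antipode_inv h) w)) \in @linear_form k W.
Proof.
apply/asboolP => a u v; rewrite linearP.
by case: f => f /= /asboolP lf; rewrite lf.
Qed.

Definition dual_act (h : H) (f : dual W) : dual W := Dual (dual_act_subproof h f).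

Lemma dual_act_linear h : linear (dual_act h).
Proof. by move=> a f g; apply/val_inj; apply/funext. Qed.

HB.instance Definition _ h :=
  GRing.isLinear.Build k (dual W) (dual W) *:%R (dual_act h) (dual_act_linear h).

Definition dual_module : module_data := @ModuleData (dual W) dual_act.

Definition coef_gen (f : dual W) (w : W) : H :=
  \tsum_(a, b <- R) \tsum_(c, d <- R) ((f (act W (c * b) w) : k) *: S (d * a)).

(* the linear span D_W of all the [coef_gen f w] *)
Definition coef_space (h : H) : Prop :=
  exists s : seq (dual W * W), h \in <<[seq coef_gen x.1 x.2 | x <- s]>>%VS.

End DualModule.

End QuasiTriangular.

(* Main.v *)
From HB Require Import structures.
Require Import Defs.
From mathcomp Require Import all_boot all_order all_algebra all_field.
From mathcomp Require Import boolp functions.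
Set Implicit Arguments.
Unset Strict Implicit.
Unset Printing Implicit Defensive.
Import GRing.Theory.
Local Open Scope ring_scope.

(** Over a factorizable Hopf algebra H the Yetter-Drinfeld modules are the
    modules over the algebra H ⊗ H, and in this description the object attached
    to W and M is the outer tensor product of W and M.  Once this is known the
    classification is the classification of simple H ⊗ H-modules.

    The description is obtained as follows.  A linear endomorphism X of H acts on
    a Yetter-Drinfeld module V by v |-> X(v_{-1}) v_0, and these operators compose
    through a product on End(H) which is the same for all V ([end_actM]): End(H)
    with this product is the Drinfeld double.  Write R = a ⊗ b = c ⊗ d for two
    copies of R.  The coaction of the object attached to W and M simplifies to
    w ⊗ m |-> S(a) d ⊗ (b w ⊗ c m) ([bar_coact_pure]); from this form it is checked
    that the object is Yetter-Drinfeld ([bar_is_yd]), and that X acts on it as an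
    element [double_map X] of H ⊗ H ([end_act_bar]).  Evaluation at 1 ⊗ 1, for
    W = M = H, shows that [double_map] is multiplicative ([double_mapM]).  It is
    bijective: after an invertible change of variables it becomes the map
    X |-> (id ⊗ X)(c b ⊗ d a), and factorizability says that the tensor
    c b ⊗ d a is nondegenerate ([double_map_inj], [double_map_surj]).  Hence H ⊗ H
    acts on every Yetter-Drinfeld module ([hh_act]), Δ(h) acting as h.  The
    coaction can be recovered from these operators, so that subobjects and
    morphisms are those of H ⊗ H-modules.

    Irreducibility: if W is simple, Schur's lemma over an algebraically closed
    field shows that a nonzero subspace of W ⊗ M stable under H ⊗ 1 contains
    W ⊗ m for some nonzero m ([tensor_submodule_slice]).  If M is simple too, a
    nonzero H ⊗ H-submodule is everything ([bar_irreducible]).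

    Exhaustion: let V be irreducible and v in V nonzero.  As H is semisimple there
    are minimal left ideals J and J' such that (J ⊗ J') v is not zero, and then
    j ⊗ j' |-> (j ⊗ j') v is a nonzero morphism between irreducible objects
    ([irreducible_yd_bar]).

    Subobjects D of H: let F be an isomorphism from the object attached to W and M
    to D.  The counit restricts to an H-invariant form on D, and it pulls back along
    F to an invariant pairing of W with M, that is, to a morphism from M to the dual
    of W ([form_map]).  It is not zero because d = d_(1) ε(d_(2)), so it is bijective
    as both modules are simple ([form_map_bij]).  The same identity expresses
    F (w ⊗ m) as a generator of the coefficient space D_W ([iso_coef_gen]), whence
    D = D_W ([coef_spaceE]). *)

(** * Multilinear calculus with Sweedler sums *)

Section SweedlerSums.
Variables (k : fieldType).
Implicit Types U V W Z : lmodType k.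

Lemma tlift_ext V W U (F G : V -> W -> U) t :
  (forall a b, F a b = G a b) -> tlift F t = tlift G t.
Proof. by move=> e; rewrite /tlift /formal_sum; apply: eq_bigr => x _. Qed.

Lemma tlift_swap V W V' W' U (F : V -> W -> V' -> W' -> U) t s :
  \tsum_(a, b <- t) \tsum_(c, d <- s) F a b c d =
  \tsum_(c, d <- s) \tsum_(a, b <- t) F a b c d.
Proof. exact: exchange_big. Qed.

Definition bundle_linear (V W : lmodType k) (f : V -> W) (lf : linear f) : {linear V -> W} :=
  HB.pack f (GRing.isLinear.Build k V W *:%R f lf).

Lemma linear_zero V U (g : V -> U) : linear g -> g 0 = 0.
Proof. move=> lg; exact: (linear0 (bundle_linear lg)). Qed.

Lemma linear_scale V U (g : V -> U) c x : linear g -> g (c *: x) = c *: g x.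
Proof. move=> lg; exact: (linearZZ (bundle_linear lg) c x). Qed.

Lemma linear_bigop V U (g : V -> U) (I : Type) (r : seq I) (F : I -> V) :
  linear g -> g (\sum_(i <- r) F i) = \sum_(i <- r) g (F i).
Proof. move=> lg; exact: (raddf_sum (bundle_linear lg)). Qed.

(** The sum over t is a sum over one chosen representative of t, so linear maps
    pass through it whatever F is. *)
Lemma tlift_push V W U Z (g : U -> Z) (F : V -> W -> U) t :
  linear g -> g (tlift F t) = \tsum_(a, b <- t) g (F a b).
Proof. by move=> lg; rewrite /tlift /formal_sum linear_bigop. Qed.

Lemma tlift_tlift V W V' W' U (F : V -> W -> U) (G : V' -> W' -> (V ⊗ W)%type) t :
  bilinear_map F -> tlift F (tlift G t) = \tsum_(a, b <- t) tlift F (G a b).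
Proof. by move=> bF; rewrite (tlift_push _ _ (tlift_linear bF)). Qed.

Lemma tlift_id V W (t : (V ⊗ W)%type) : \tsum_(a, b <- t) a ⊗ b = t.
Proof.
apply: tensor_ext => U f bf; rewrite tlift_tlift //; apply: tlift_ext => a b.
by rewrite tlift_pure.
Qed.

Lemma bilinear_mapI V W U (F : V -> W -> U) :
  (forall w, linear (fun v => F v w)) -> (forall v, linear (fun w => F v w)) ->
  bilinear_map F.
Proof. by move=> l r; split; split. Qed.

Lemma bilinear_left V W U (F : V -> W -> U) : bilinear_map F -> forall w, linear (F^~ w).
Proof. by case=> -[]. Qed.
Lemma bilinear_right V W U (F : V -> W -> U) : bilinear_map F -> forall v, linear (F v).
Proof. by case=> -[]. Qed.

Lemma id_linear V : linear (fun x : V => x). Proof. by []. Qed.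
Lemma comp_linear V U Z (g : U -> Z) (f : V -> U) :
  linear g -> linear f -> linear (fun x => g (f x)).
Proof. by move=> lg lf a x y; rewrite lf lg. Qed.
(** A sum over a fixed t is a sum over a fixed finite list. *)
Lemma tlift_param_linear V W U Z (F : Z -> V -> W -> U) t :
  (forall a b, linear (fun x => F x a b)) -> linear (fun x => tlift (F x) t).
Proof.
move=> lF c x y; rewrite /tlift /formal_sum scaler_sumr -big_split.
by apply: eq_bigr => i _; rewrite lF.
Qed.
Lemma scale_linearl V W (f : V -> k^o) (w : W) :
  linear f -> linear (fun v => (f v : k) *: w).
Proof. by move=> lf a x y; rewrite lf scalerDl scalerA. Qed.
Lemma scale_linearr V c : linear (fun v : V => c *: v).
Proof. by move=> a x y; rewrite scalerDr !scalerA mulrC. Qed.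
Lemma pure_linearl V W (w : W) : linear (fun v : V => v ⊗ w).
Proof. exact: bilinear_left (pure_bilinear V W) w. Qed.
Lemma pure_linearr V W (v : V) : linear (fun w : W => v ⊗ w).
Proof. exact: bilinear_right (pure_bilinear V W) v. Qed.
Lemma mul_linearl (B : falgType k) (c : B) : linear (fun x : B => x * c).
Proof. by move=> a x y; rewrite mulrDl scalerAl. Qed.
Lemma mul_linearr (B : falgType k) (c : B) : linear (fun x : B => c * x).
Proof. by move=> a x y; rewrite mulrDr scalerAr. Qed.
Lemma dual_linear V (p : dual V) : linear (p : V -> k^o).
Proof. by case: p => p /= /asboolP. Qed.

End SweedlerSums.
Arguments tlift_id {k V W} t.

Definition trilinear (k : fieldType) (U V W Z : lmodType k) (F : U -> V -> W -> Z) : Prop :=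
  [/\ forall v w, linear (fun u => F u v w), forall u w, linear (fun v => F u v w)
    & forall u v, linear (fun w => F u v w)].

(** [lin] proves that an expression in Sweedler notation is linear, bilinear or
    trilinear in its bound variables, by descending to the place where the variable
    occurs.  A pattern variable under a binder may capture the binder, so that the
    position of the variable is decided by unification, with [is_const]. *)
Ltac is_const f :=
  assert_succeeds (lazymatch type of f with ?A -> ?B =>
    let c := open_constr:(_ : B) in unify f (fun _ : A => c) end).
Ltac linear_by_hyp := solve [match goal with H : _ |- _ => exact: H end].
Ltac linear_by_bilinear := match goal with
  | h : bilinear_map ?F |- _ => exact: (bilinear_left h)
  | h : bilinear_map ?F |- _ => exact: (bilinear_right h)
  | h : forall x, bilinear_map (?F x) |- _ => exact: (bilinear_left (h _))
  | h : forall x, bilinear_map (?F x) |- _ => exact: (bilinear_right (h _))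
  | h : trilinear ?F |- _ => case: h => ? ? ?; linear_by_hyp
  end.
Ltac linear_leaf :=
  solve [ linear_by_hyp | linear_by_bilinear | exact: linearP | exact: dual_linear
        | exact: pure_linearr
        | exact: mul_linearr | exact: scale_linearr ].
Ltac lin :=
  lazymatch goal with
  | |- forall _, _ => intros; lin
  | |- trilinear _ => split; lin
  | |- bilinear_map _ => solve [linear_by_hyp | apply: bilinear_mapI; intros; lin]
  | |- GRing.linear_for _ (tlift _) => apply: tlift_linear; lin
  | |- GRing.linear_for _ (fun x => x) => exact: id_linear
  | |- GRing.linear_for _ (fun x => tlift (@?F x) (@?g x)) =>
     tryif is_const g then
       lazymatch goal with
       | |- GRing.linear_for _ (fun x => tlift _ ?t) =>
         refine (@tlift_param_linear _ _ _ _ _ F t _); intros; lin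
       end
     else lazymatch goal with
       | |- GRing.linear_for _ (fun x => tlift ?F _) =>
         refine (@comp_linear _ _ _ _ (tlift F) g _ _); [apply: tlift_linear; lin | lin]
       end
  | |- GRing.linear_for _ (fun x => pure (@?f x) (@?g x)) =>
     tryif is_const f then linear_app else
     lazymatch goal with
     | |- GRing.linear_for _ (fun x => pure _ ?c) =>
       refine (@comp_linear _ _ _ _ (fun y => pure y c) f _ _); [exact: pure_linearl | lin]
     end
  | |- GRing.linear_for _ (fun x => @GRing.mul _ (@?f x) (@?g x)) =>
     tryif is_const f then linear_app else
     lazymatch goal with
     | |- GRing.linear_for _ (fun x => @GRing.mul _ _ ?c) =>
       refine (@comp_linear _ _ _ _ (fun y => y * c) f _ _); [exact: mul_linearl | lin]
     end
  | |- GRing.linear_for _ (fun x => @GRing.scale _ _ (@?f x) (@?g x)) =>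
     tryif is_const f then linear_app else
     lazymatch goal with
     | |- GRing.linear_for _ (fun x => @GRing.scale _ _ _ ?c) =>
       refine (@scale_linearl _ _ _ f c _); lin
     end
  | |- GRing.linear_for _ (fun x => GRing.Linear.sort (act ?V (@?f x)) (@?g x)) =>
     tryif is_const f then linear_app else
     lazymatch goal with
     | |- GRing.linear_for _ (fun x => GRing.Linear.sort (act ?V _) ?c) =>
       refine (@comp_linear _ _ _ _ (fun y => act V y c) f _ _);
       [apply: act_linear; linear_by_hyp | lin]
     end
  | |- GRing.linear_for _ (fun x => _ (@?f x)) =>
     tryif is_const f then
       first [ linear_leaf
       | lazymatch goal with
         | |- GRing.linear_for _ (fun x => ?g (@?e x) (@?f x)) =>
           tryif is_const e then
             lazymatch goal with
             | |- GRing.linear_for _ (fun x => ?g (@?e x) ?y ?z) =>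
               refine (@comp_linear _ _ _ _ (fun x => g x y z) e _ _); [ linear_leaf | lin ]
             end
           else
             lazymatch goal with
             | |- GRing.linear_for _ (fun x => ?g _ ?y) =>
               refine (@comp_linear _ _ _ _ (fun x => g x y) e _ _); [ linear_leaf | lin ]
             end
         end ]
     else linear_app
  | |- _ => linear_leaf
  end
with linear_app :=
  first [ linear_leaf |
  lazymatch goal with
  | |- GRing.linear_for _ (fun x => ?g (@?f x)) =>
     refine (@comp_linear _ _ _ _ g f _ _); [ linear_leaf | lin ]
  end ].

Section Trilinear.
Variables (k : fieldType) (U V W Z : lmodType k) (F : U -> V -> W -> Z).
Hypothesis tF : trilinear F.

Definition trilift (t : (U ⊗ (V ⊗ W))%type) : Z :=
  \tsum_(x, s <- t) \tsum_(y, z <- s) F x y z.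

Lemma trilinear_bilinear x : bilinear_map (F x).
Proof. by case: tF => l1 l2 l3; lin. Qed.

Lemma trilift_bilinear : bilinear_map (fun x (s : (V ⊗ W)%type) => \tsum_(y, z <- s) F x y z).
Proof. by have := trilinear_bilinear; case: tF => l1 l2 l3 ?; lin. Qed.

Lemma trilift_linear : linear trilift.
Proof. exact: tlift_linear trilift_bilinear. Qed.

Lemma trilift_pure x s : trilift (x ⊗ s) = tlift (F x) s.
Proof. by rewrite /trilift tlift_pure //; exact: trilift_bilinear. Qed.

Lemma trilift_pure3 x y z : trilift (x ⊗ (y ⊗ z)) = F x y z.
Proof. by rewrite trilift_pure tlift_pure //; exact: trilinear_bilinear. Qed.

End Trilinear.

(** * Identities for the antipode and the R-matrix *)

Section HopfIdentities.
Variables (k : fieldType) (H : falgType k) (A : hopf_algebra H).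
Local Notation Δ := (coprod A).
Local Notation S := (antipode A).
Local Notation ε := (counit A).

(** This is the axiom in the form used for calculations: an identity between
    threefold tensors may be evaluated at any trilinear expression.  The same device
    is used below for the other axioms. *)
Lemma coassoc (Z : lmodType k) (F : H -> H -> H -> Z) h : trilinear F ->
  \tsum_(a, b <- Δ h) \tsum_(a1, a2 <- Δ a) F a1 a2 b =
  \tsum_(a, b <- Δ h) \tsum_(b1, b2 <- Δ b) F a b1 b2.
Proof.
move=> tF; have := congr1 (trilift F) (coprodA A h).
rewrite !(tlift_push _ _ (trilift_linear tF)) => e.
etransitivity; last (etransitivity; first exact: e).
  apply: tlift_ext => a b; rewrite (tlift_push _ _ (trilift_linear tF)).
  by apply: tlift_ext => c d; rewrite trilift_pure3.
by apply: tlift_ext => a b; rewrite trilift_pure.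
Qed.

Lemma counitl_app (Z : lmodType k) (F : H -> Z) h : linear F ->
  \tsum_(a, b <- Δ h) ((ε a : k) *: F b) = F h.
Proof.
move=> lF; rewrite -[in RHS](counitl A h) (tlift_push _ _ lF).
by apply: tlift_ext => a b; rewrite linear_scale.
Qed.

Lemma counitr_app (Z : lmodType k) (F : H -> Z) h : linear F ->
  \tsum_(a, b <- Δ h) ((ε b : k) *: F a) = F h.
Proof.
move=> lF; rewrite -[in RHS](counitr A h) (tlift_push _ _ lF).
by apply: tlift_ext => a b; rewrite linear_scale.
Qed.

Lemma antipodel_app (Z : lmodType k) (F : H -> Z) h : linear F ->
  \tsum_(a, b <- Δ h) F (S a * b) = (ε h : k) *: F 1.
Proof. by move=> lF; rewrite -linear_scale // -(antipodel A) (tlift_push _ _ lF). Qed.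

Lemma antipoder_app (Z : lmodType k) (F : H -> Z) h : linear F ->
  \tsum_(a, b <- Δ h) F (a * S b) = (ε h : k) *: F 1.
Proof. by move=> lF; rewrite -linear_scale // -(antipoder A) (tlift_push _ _ lF). Qed.

Lemma tmul_app (Z : lmodType k) (F : H -> H -> Z) s t : bilinear_map F ->
  tlift F (tmul s t) = \tsum_(a, b <- s) \tsum_(c, d <- t) F (a * c) (b * d).
Proof.
move=> bF; rewrite /tmul tlift_tlift //; apply: tlift_ext => a b.
by rewrite tlift_tlift //; apply: tlift_ext => c d; rewrite tlift_pure.
Qed.

Lemma coprodM_app (Z : lmodType k) (F : H -> H -> Z) g h : bilinear_map F ->
  tlift F (Δ (g * h)) = \tsum_(a, b <- Δ g) \tsum_(c, d <- Δ h) F (a * c) (b * d).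
Proof. by move=> bF; rewrite coprodM tmul_app. Qed.

Lemma coprod1_app (Z : lmodType k) (F : H -> H -> Z) : bilinear_map F ->
  tlift F (Δ 1) = F 1 1.
Proof. by move=> bF; rewrite coprod1 tlift_pure. Qed.

Lemma antipode1 : S 1 = 1.
Proof.
by have := antipodel_app 1 (@id_linear k H); rewrite coprod1_app ?counit1 ?scale1r ?mulr1 //; lin.
Qed.

Lemma counit_antipode h : ε (S h) = ε h.
Proof.
transitivity (\tsum_(a, b <- Δ h) (ε (S a * b) : k^o)).
  rewrite -(@counitr_app k^o (fun x => ε (S x))); last by lin.
  by apply: tlift_ext => a b; rewrite counitM mulrC.
by rewrite (@antipodel_app k^o (fun x => ε x)) ?counit1; [exact: mulr1|lin].
Qed.

(** Both sides are convolution inverses, on H ⊗ H, of the product: the sum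
    S(g1 h1) g2 h2 S(h3) S(g3) collapses to either side. *)
Lemma antipodeM g h : S (g * h) = S h * S g.
Proof.
symmetry.
transitivity (\tsum_(a, x <- Δ g) \tsum_(b, y <- Δ h) \tsum_(a1, a2 <- Δ a)
   \tsum_(b1, b2 <- Δ b) (S (a1 * b1) * (a2 * b2) * (S y * S x))).
  rewrite -[LHS](@counitl_app _ (fun x => S h * S x)); last by lin.
  apply: tlift_ext => a x.
  rewrite -(@counitl_app _ (fun y => S y * S x)); last by lin.
  rewrite (tlift_push _ _ (scale_linearr _)); apply: tlift_ext => b y.
  rewrite scalerA -(counitM A) -[RHS](coprodM_app (F := fun u v => S u * v * (S y * S x))).
    by rewrite (antipodel_app (F := fun z => z * (S y * S x))) ?mul1r //; lin.
  lin.
transitivity (\tsum_(a, x <- Δ g) \tsum_(a1, a2 <- Δ x) \tsum_(b, y <- Δ h)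
   \tsum_(b1, b2 <- Δ y) (S (a * b) * (a1 * b1) * (S b2 * S a2))).
  rewrite -coassoc; last by lin.
  apply: tlift_ext => a x; rewrite tlift_swap; apply: tlift_ext => a1 a2.
  by apply: (coassoc (F := fun b1 b2 y => S (a1 * b1) * (a2 * b2) * (S y * S x))); lin.
transitivity (\tsum_(a, x <- Δ g) \tsum_(a1, a2 <- Δ x) (S (a * h) * (a1 * S a2))).
  apply: tlift_ext => a x; apply: tlift_ext => a1 a2.
  rewrite -(@counitr_app _ (fun b => S (a * b) * (a1 * S a2))); last by lin.
  apply: tlift_ext => b y.
  rewrite -[in RHS](mul1r (S a2)).
  rewrite -(antipoder_app (F := fun z => S (a * b) * (a1 * (z * S a2)))); last by lin.
  by apply: tlift_ext => b1 b2; rewrite !mulrA.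
rewrite -[RHS](@counitr_app _ (fun a => S (a * h))); last by lin.
apply: tlift_ext => a x.
by rewrite (antipoder_app (F := fun z => S (a * h) * z)) ?mulr1 //; lin.
Qed.

Variable R : (H ⊗ H)%type.
Hypothesis HR : quasi_triangular A R.

Lemma R_coprodl (Z : lmodType k) (F : H -> H -> H -> Z) : trilinear F ->
  \tsum_(x, y <- R) \tsum_(x1, x2 <- Δ x) F x1 x2 y =
  \tsum_(a, b <- R) \tsum_(c, d <- R) F a c (b * d).
Proof.
move=> tF; have lF := trilift_linear tF; have := congr1 (trilift F) (Rmatrix_coprodl HR).
rewrite !(tlift_push _ _ lF) => e.
etransitivity; last (etransitivity; first exact: e).
  apply: tlift_ext => a b; rewrite (tlift_push _ _ lF).
  by apply: tlift_ext => c d; rewrite trilift_pure3.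
apply: tlift_ext => a b; rewrite (tlift_push _ _ lF).
by apply: tlift_ext => c d; rewrite trilift_pure3.
Qed.

Lemma R_coprodr (Z : lmodType k) (F : H -> H -> H -> Z) : trilinear F ->
  \tsum_(x, y <- R) \tsum_(y1, y2 <- Δ y) F x y1 y2 =
  \tsum_(a, b <- R) \tsum_(c, d <- R) F (a * c) d b.
Proof.
move=> tF; have lF := trilift_linear tF; have := congr1 (trilift F) (Rmatrix_coprodr HR).
rewrite !(tlift_push _ _ lF) => e.
etransitivity; last (etransitivity; first exact: e).
  by apply: tlift_ext => a b; rewrite trilift_pure.
apply: tlift_ext => a b; rewrite (tlift_push _ _ lF).
by apply: tlift_ext => c d; rewrite trilift_pure3.
Qed.

Lemma R_intertwine (Z : lmodType k) (F : H -> H -> Z) h : bilinear_map F ->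
  \tsum_(a, b <- R) \tsum_(h1, h2 <- Δ h) F (a * h1) (b * h2) =
  \tsum_(a, b <- R) \tsum_(h1, h2 <- Δ h) F (h2 * a) (h1 * b).
Proof.
move=> bF; have := congr1 (tlift F) (Rmatrix_intertwine HR h).
rewrite !tmul_app // => ->; rewrite tlift_tlift; last by lin.
rewrite [RHS]tlift_swap; apply: tlift_ext => a b.
by rewrite tlift_pure //; lin.
Qed.

Lemma tmulA : associative (@tmul k H).
Proof.
move=> s t u; rewrite [RHS]/tmul [in RHS]tmul_app; last by lin.
rewrite [LHS]/tmul; apply: tlift_ext => a b.
rewrite tmul_app; last by lin.
apply: tlift_ext => c d; apply: tlift_ext => e f.
by rewrite !mulrA.
Qed.

Lemma tmul1l (t : (H ⊗ H)%type) : tmul (1 ⊗ 1) t = t.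
Proof.
rewrite /tmul tlift_pure; last by lin.
by rewrite -[RHS]tlift_id; apply: tlift_ext => a b; rewrite !mul1r.
Qed.
Lemma tmul1r (t : (H ⊗ H)%type) : tmul t (1 ⊗ 1) = t.
Proof.
rewrite /tmul -[RHS]tlift_id; apply: tlift_ext => a b.
by rewrite tlift_pure ?mulr1 //; lin.
Qed.

Lemma R_cancel s : tmul s R = R -> s = 1 ⊗ 1.
Proof.
case: (Rmatrix_inv HR) => R' [RR' _] e.
by rewrite -[s]tmul1r -RR' tmulA e.
Qed.
(** Applying ε to the first leg of (Δ ⊗ id) R = R13 R23 gives
    R = (1 ⊗ ε(a) b) R, and R is invertible. *)
Lemma R_counitl_tensor : 1 ⊗ (\tsum_(a, b <- R) ((ε a : k) *: b)) = 1 ⊗ 1 :> (H ⊗ H)%type.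
Proof.
apply: R_cancel; rewrite /tmul tlift_pure; last by lin.
rewrite -[RHS]tlift_id.
transitivity (\tsum_(x, y <- R) \tsum_(x1, x2 <- Δ x) ((ε x1 : k) *: (x2 ⊗ y))); last first.
  by apply: tlift_ext => x y; apply: (counitl_app (F := fun z => z ⊗ y)); lin.
rewrite (R_coprodl (F := fun x y z => (ε x : k) *: (y ⊗ z))); last by lin.
rewrite tlift_swap; apply: tlift_ext => c d; rewrite mul1r.
rewrite (tlift_push _ _ (mul_linearl _)) (tlift_push _ _ (pure_linearr _)).
by apply: tlift_ext => a b; rewrite -scalerAl (linear_scale _ _ (pure_linearr _)).
Qed.

Lemma R_counitr_tensor : (\tsum_(a, b <- R) ((ε b : k) *: a)) ⊗ 1 = 1 ⊗ 1 :> (H ⊗ H)%type.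
Proof.
apply: R_cancel; rewrite /tmul tlift_pure; last by lin.
rewrite -[RHS]tlift_id.
transitivity (\tsum_(x, y <- R) \tsum_(y1, y2 <- Δ y) ((ε y2 : k) *: (x ⊗ y1))); last first.
  by apply: tlift_ext => x y; apply: (counitr_app (F := fun z => x ⊗ z)); lin.
rewrite (R_coprodr (F := fun x y z => (ε z : k) *: (x ⊗ y))); last by lin.
rewrite tlift_swap; apply: tlift_ext => c d; rewrite mul1r.
rewrite (tlift_push _ _ (mul_linearl _)) (tlift_push _ _ (pure_linearl _)).
by apply: tlift_ext => a b; rewrite -scalerAl (linear_scale _ _ (pure_linearl _)).
Qed.

Lemma R_counitl : \tsum_(a, b <- R) ((ε a : k) *: b) = 1.
Proof.
have /(congr1 (tlift (fun a b : H => a * b))) := R_counitl_tensor.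
by rewrite !tlift_pure ?mul1r //; lin.
Qed.

Lemma R_counitr : \tsum_(a, b <- R) ((ε b : k) *: a) = 1.
Proof.
have /(congr1 (tlift (fun a b : H => a * b))) := R_counitr_tensor.
by rewrite !tlift_pure ?mulr1 //; lin.
Qed.

Lemma R_counitl_app (Z : lmodType k) (F : H -> Z) : linear F ->
  \tsum_(a, b <- R) ((ε a : k) *: F b) = F 1.
Proof.
move=> lF; rewrite -R_counitl (tlift_push _ _ lF).
by apply: tlift_ext => a b; rewrite linear_scale.
Qed.
Lemma R_counitr_app (Z : lmodType k) (F : H -> Z) : linear F ->
  \tsum_(a, b <- R) ((ε b : k) *: F a) = F 1.
Proof.
move=> lF; rewrite -R_counitr (tlift_push _ _ lF).
by apply: tlift_ext => a b; rewrite linear_scale.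
Qed.

(** The next four identities say that S(a) ⊗ b is inverse to R in H ⊗ H, and that
    a ⊗ S(b) is inverse to R when the product of the second leg is reversed.  They
    come from applying the antipode axioms to (Δ ⊗ id) R and (id ⊗ Δ) R. *)
Lemma R_Sl_inv (Z : lmodType k) (F : H -> H -> Z) : bilinear_map F ->
  \tsum_(a, b <- R) \tsum_(c, d <- R) F (S a * c) (b * d) = F 1 1.
Proof.
move=> bF; have l1 := bilinear_left bF; have l2 := bilinear_right bF.
rewrite -(R_coprodl (F := fun x y z => F (S x * y) z)); last by lin.
rewrite -(R_counitl_app (F := F 1)) //; apply: tlift_ext => a b.
by rewrite (antipodel_app (F := fun x => F x b)).
Qed.
Lemma R_Sr_inv (Z : lmodType k) (F : H -> H -> Z) : bilinear_map F ->
  \tsum_(a, b <- R) \tsum_(c, d <- R) F (a * S c) (b * d) = F 1 1.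
Proof.
move=> bF; have l1 := bilinear_left bF; have l2 := bilinear_right bF.
rewrite -(R_coprodl (F := fun x y z => F (x * S y) z)); last by lin.
rewrite -(R_counitl_app (F := F 1)) //; apply: tlift_ext => a b.
by rewrite (antipoder_app (F := fun x => F x b)).
Qed.
Lemma R_Sl_inv_right (Z : lmodType k) (F : H -> H -> Z) : bilinear_map F ->
  \tsum_(a, b <- R) \tsum_(c, d <- R) F (a * c) (S d * b) = F 1 1.
Proof.
move=> bF; have l1 := bilinear_left bF; have l2 := bilinear_right bF.
rewrite -(R_coprodr (F := fun x y z => F x (S y * z))); last by lin.
rewrite -(R_counitr_app (F := fun x => F x 1)) //; apply: tlift_ext => a b.
by rewrite (antipodel_app (F := fun x => F a x)).
Qed.
Lemma R_Sr_inv_right (Z : lmodType k) (F : H -> H -> Z) : bilinear_map F ->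
  \tsum_(a, b <- R) \tsum_(c, d <- R) F (a * c) (d * S b) = F 1 1.
Proof.
move=> bF; have l1 := bilinear_left bF; have l2 := bilinear_right bF.
rewrite -(R_coprodr (F := fun x y z => F x (y * S z))); last by lin.
rewrite -(R_counitr_app (F := fun x => F x 1)) //; apply: tlift_ext => a b.
by rewrite (antipoder_app (F := fun x => F a x)).
Qed.

Definition R_inv : (H ⊗ H)%type := \tsum_(a, b <- R) S a ⊗ b.

Lemma R_invR : tmul R_inv R = 1 ⊗ 1.
Proof.
rewrite /tmul /R_inv tlift_tlift; last by lin.
rewrite -[RHS](R_Sl_inv (F := fun x y => x ⊗ y)); last by lin.
by apply: tlift_ext => a b; rewrite tlift_pure //; lin.
Qed.

Lemma RR_inv : tmul R R_inv = 1 ⊗ 1.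
Proof.
rewrite /tmul /R_inv -[RHS](R_Sr_inv (F := fun x y => x ⊗ y)); last by lin.
apply: tlift_ext => a b; rewrite tlift_tlift; last by lin.
by apply: tlift_ext => c d; rewrite tlift_pure //; lin.
Qed.

Lemma R_inv_app (Z : lmodType k) (F : H -> H -> Z) : bilinear_map F ->
  tlift F R_inv = \tsum_(a, b <- R) F (S a) b.
Proof.
move=> bF; rewrite tlift_tlift //.
by apply: tlift_ext => a b; rewrite tlift_pure.
Qed.

(** Applying S to the first leg of the identity a c ⊗ S(d) b = 1 ⊗ 1 shows that
    S(a) ⊗ S(b) is a left inverse of [R_inv], hence equal to R. *)
Lemma R_antipode2 : \tsum_(a, b <- R) S a ⊗ S b = R.
Proof.
have e : tmul (\tsum_(a, b <- R) S a ⊗ S b) R_inv = 1 ⊗ 1.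
  transitivity (\tsum_(a, b <- R) \tsum_(c, d <- R) S (a * c) ⊗ (S d * b)).
    rewrite {1}/tmul tlift_tlift; last by lin.
    rewrite [RHS]tlift_swap; apply: tlift_ext => a b.
    rewrite tlift_pure; last by lin.
    rewrite R_inv_app; last by lin.
    by apply: tlift_ext => c d; rewrite antipodeM.
  by rewrite (R_Sl_inv_right (F := fun x y => S x ⊗ y)) ?antipode1 //; lin.
by rewrite -[LHS]tmul1r -R_invR tmulA e tmul1l.
Qed.

Lemma R_antipode2_app (Z : lmodType k) (F : H -> H -> Z) : bilinear_map F ->
  \tsum_(a, b <- R) F (S a) (S b) = tlift F R.
Proof.
move=> bF; rewrite -[in RHS]R_antipode2 tlift_tlift //.
by apply: tlift_ext => a b; rewrite tlift_pure.
Qed.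

Hypothesis Hfact : factorizable R.

(** As R = (S ⊗ S) R and S reverses products, the image of the Drinfeld map is
    contained in S(H); it is all of H by factorizability. *)
Lemma antipode_surj h : exists g, S g = h.
Proof.
have [psi _ psiK] := Hfact; set p := psi h; rewrite -[h]psiK.
exists (\tsum_(a, b <- R) \tsum_(c, d <- R) ((p (S b * S c) : k) *: (d * a))).
rewrite (tlift_push _ _ (linearP S)) /drinfeld_map.
rewrite -[RHS](R_antipode2_app (F := fun a b =>
  \tsum_(c, d <- R) ((p (b * c) : k) *: (a * d)))); last by lin.
apply: tlift_ext => a b; rewrite (tlift_push _ _ (linearP S)).
rewrite -[RHS](R_antipode2_app (F := fun c d => (p (S b * c) : k) *: (S a * d))); last by lin.
by apply: tlift_ext => c d; rewrite linearZ /= antipodeM.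
Qed.

Local Notation Si := (antipode_inv A).

Lemma antipodeK : cancel Si S.
Proof.
by move=> h; have [g <-] := antipode_surj h; apply: limg_lfunVK; rewrite memv_img ?memvf.
Qed.

Lemma antipode_inj : injective S.
Proof.
have kS : lker S == 0%VS.
  rewrite -dimv_eq0; have := limg_ker_dim S fullv; rewrite capfv.
  suff -> : (S @: fullv = fullv)%VS by move/eqP; rewrite -[X in _ == X]add0n eqn_add2r.
  apply/eqP; rewrite eqEsubv subvf; apply/subvP => h _.
  by have [g <-] := antipode_surj h; rewrite memv_img ?memvf.
exact/lker0P.
Qed.

Lemma antipode_invK : cancel S Si.
Proof. by move=> h; apply: antipode_inj; rewrite antipodeK. Qed.

Lemma antipode_inv_linear : linear Si.
Proof. exact: linearP. Qed.

Lemma antipode_invM g h : Si (g * h) = Si h * Si g.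
Proof. by apply: antipode_inj; rewrite antipodeM !antipodeK. Qed.

Lemma antipode_inv1 : Si 1 = 1.
Proof. by apply: antipode_inj; rewrite antipodeK antipode1. Qed.

Lemma antipode_invl_app (Z : lmodType k) (F : H -> Z) h : linear F ->
  \tsum_(a, b <- Δ h) F (Si b * a) = (ε h : k) *: F 1.
Proof.
move=> lF; have l := antipode_inv_linear.
rewrite -antipode_inv1 -(antipodel_app (F := fun x => F (Si x))); last by lin.
by apply: tlift_ext => a b; rewrite antipode_invM antipode_invK.
Qed.
Lemma antipode_invr_app (Z : lmodType k) (F : H -> Z) h : linear F ->
  \tsum_(a, b <- Δ h) F (b * Si a) = (ε h : k) *: F 1.
Proof.
move=> lF; have l := antipode_inv_linear.
rewrite -antipode_inv1 -(antipoder_app (F := fun x => F (Si x))); last by lin.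
by apply: tlift_ext => a b; rewrite antipode_invM antipode_invK.
Qed.

End HopfIdentities.

(** * The Yetter-Drinfeld module attached to two modules *)

Section TensorExt.
Variables (k : fieldType).
Lemma tensor_linear_ext (V W U : lmodType k) (f g : (V ⊗ W)%type -> U) :
  linear f -> linear g -> (forall v w, f (v ⊗ w) = g (v ⊗ w)) -> f =1 g.
Proof.
move=> lf lg e t; rewrite -[t]tlift_id (tlift_push _ _ lf) (tlift_push _ _ lg).
exact: tlift_ext.
Qed.
Lemma tmul_bilinear (H : falgType k) : bilinear_map (@tmul k H).
Proof. rewrite /tmul; lin. Qed.
End TensorExt.

Section Bar.
Variables (k : fieldType) (H : falgType k) (A : hopf_algebra H).
Local Notation Δ := (coprod A).
Local Notation S := (antipode A).
Local Notation ε := (counit A).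
Local Notation HH := (H ⊗ H)%type.

(** Half of the proof that S reverses the coproduct: h |-> S(h2) ⊗ S(h1) is a left
    convolution inverse of Δ. *)
Lemma coprod_antipode_aux h :
  \tsum_(a1, a2 <- Δ h) tmul (\tsum_(p, q <- Δ a1) S q ⊗ S p) (Δ a2) = (ε h : k) *: (1 ⊗ 1).
Proof.
transitivity (\tsum_(a1, a2 <- Δ h) \tsum_(p, q <- Δ a1) \tsum_(r, s <- Δ a2)
   (S q * r) ⊗ (S p * s)).
  apply: tlift_ext => a1 a2; rewrite {1}/tmul tlift_tlift; last by lin.
  by apply: tlift_ext => p q; rewrite tlift_pure //; lin.
rewrite (coassoc A (F := fun p q a2 => \tsum_(r, s <- Δ a2) (S q * r) ⊗ (S p * s))); last by lin.
transitivity (\tsum_(p, x <- Δ h) (1 : H) ⊗ (S p * x)); last first.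
  by rewrite (antipodel_app A (F := fun z => (1 : H) ⊗ z)) //; lin.
apply: tlift_ext => p x.
rewrite -(coassoc A (F := fun q r s => (S q * r) ⊗ (S p * s))); last by lin.
rewrite -(counitl_app A (F := fun s => (1 : H) ⊗ (S p * s))); last by lin.
apply: tlift_ext => y s.
by rewrite (antipodel_app A (F := fun z => z ⊗ (S p * s))) //; lin.
Qed.

(** Δ(S(h)) is a right convolution inverse of Δ, and left and right inverses
    agree. *)
Lemma coprod_antipode h : Δ (S h) = \tsum_(a, b <- Δ h) S b ⊗ S a.
Proof.
have bt := tmul_bilinear H; symmetry; pose g h : HH := \tsum_(a, b <- Δ h) S b ⊗ S a.
have lg : linear g by rewrite /g; lin.
rewrite -[LHS]/(g h) -(counitr_app A h lg).
transitivity (\tsum_(a, b <- Δ h) \tsum_(b1, b2 <- Δ b) tmul (g a) (tmul (Δ b1) (Δ (S b2)))).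
  apply: tlift_ext => a b.
  transitivity (\tsum_(b1, b2 <- Δ b) tmul (g a) (Δ (b1 * S b2))).
    rewrite (antipoder_app A (F := fun z => tmul (g a) (Δ z))); last by lin.
    by rewrite coprod1 tmul1r.
  by apply: tlift_ext => b1 b2; rewrite coprodM.
rewrite -(coassoc A (F := fun a b1 b2 => tmul (g a) (tmul (Δ b1) (Δ (S b2))))); last by lin.
rewrite -[RHS](counitl_app A (F := fun b => Δ (S b))); last by lin.
apply: tlift_ext => a b; rewrite -[in RHS](tmul1l (Δ (S b))).
rewrite -(linear_scale _ _ (bilinear_left (tmul_bilinear H) _)) -coprod_antipode_aux.
rewrite (tlift_push _ _ (bilinear_left (tmul_bilinear H) _)).
by apply: tlift_ext => a1 a2; rewrite tmulA.
Qed.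

Lemma coprod_antipode_app (Z : lmodType k) (F : H -> H -> Z) h : bilinear_map F ->
  tlift F (Δ (S h)) = \tsum_(a, b <- Δ h) F (S b) (S a).
Proof.
move=> bF; rewrite coprod_antipode tlift_tlift //.
by apply: tlift_ext => a b; rewrite tlift_pure.
Qed.

Variable R : HH.
Hypothesis HR : quasi_triangular A R.

(** Conjugation of R Δ = Δ^op R by the inverse of R. *)
Lemma R_inv_intertwine (Z : lmodType k) (F : H -> H -> Z) h : bilinear_map F ->
  \tsum_(a, b <- R) \tsum_(h1, h2 <- Δ h) F (S a * h2) (b * h1) =
  \tsum_(a, b <- R) \tsum_(h1, h2 <- Δ h) F (h1 * S a) (h2 * b).
Proof.
move=> bF.
have e : tmul (R_inv A R) (tswap (Δ h)) = tmul (Δ h) (R_inv A R).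
  rewrite -[LHS]tmul1r -(RR_inv HR) -tmulA [X in tmul _ X]tmulA -(Rmatrix_intertwine HR h).
  by rewrite -tmulA tmulA (R_invR HR) tmul1l.
have /(congr1 (tlift F)) := e.
rewrite !tmul_app // R_inv_app; last by rewrite /tswap; lin.
move=> e'; etransitivity; first (etransitivity; last exact: e').
  apply: tlift_ext => a b; rewrite /tswap tlift_tlift; last by lin.
  by apply: tlift_ext => c d; rewrite tlift_pure //; lin.
rewrite [RHS]tlift_swap; apply: tlift_ext => h1 h2.
by rewrite R_inv_app //; lin.
Qed.

Lemma R_inv_coprodl (Z : lmodType k) (F : H -> H -> H -> Z) : trilinear F ->
  \tsum_(x, y <- R) \tsum_(x1, x2 <- Δ (S x)) F x1 x2 y =
  \tsum_(a, b <- R) \tsum_(c, d <- R) F (S c) (S a) (b * d).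
Proof.
move=> tF; rewrite -(R_coprodl HR (F := fun x1 x2 y => F (S x2) (S x1) y)); last first.
  by case: tF => l1 l2 l3; lin.
apply: tlift_ext => x y; rewrite coprod_antipode_app //.
by case: tF => l1 l2 l3; lin.
Qed.

Section BarTensor.
Variables W M : module_data H.
Hypotheses (HW : is_module W) (HM : is_module M).
Local Notation bar := (bar_tensor A R W M).

Lemma tensor_act_pure h w m : tensor_act A h (w ⊗ m) =
  \tsum_(h1, h2 <- Δ h) act W h1 w ⊗ act M h2 m.
Proof. by apply: tlift_ext => h1 h2; rewrite tlift_pure //; lin. Qed.

Definition bar_rho (w : W) (m : M) : (H ⊗ (W ⊗ M))%type :=
  \tsum_(a, b <- R) \tsum_(c, d <- R) (S a * d) ⊗ (act W b w ⊗ act M c m).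

(** Expanding the action of the extra copy e ⊗ f of R by (Δ ⊗ id) R = R13 R23
    produces e c ⊗ S(d) f, where e c acts on W, and this cancels. *)
Lemma bar_coactE t : @coact _ _ bar t = tlift bar_rho t.
Proof.
rewrite /= /bar_coactR tlift_tlift; last by lin.
apply: tlift_ext => w m; rewrite tlift_tlift; last by lin.
pose G x y p q r : (H ⊗ (W ⊗ M))%type := (x * r) ⊗ (act W (p * y) w ⊗ act M q m).
transitivity (\tsum_(a, b <- R) \tsum_(e, f <- R) \tsum_(p, s <- R) \tsum_(c, d <- R)
    (S a * (S d * f) * s) ⊗ (act W (e * c) (act W b w) ⊗ act M p m)).
  apply: tlift_ext => a b; rewrite tlift_tlift; last by lin.
  transitivity (\tsum_(c, d <- R) \tsum_(x, y <- R) \tsum_(e, p <- Δ x)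
    (S a * S d * y) ⊗ (act W (e * c) (act W b w) ⊗ act M p m)).
    apply: tlift_ext => c d; rewrite tlift_pure; last by lin.
    apply: tlift_ext => x y; rewrite /= tensor_act_pure.
    rewrite (tlift_push _ _ (pure_linearr _)); apply: tlift_ext => e p.
    by rewrite antipodeM !(actM HW).
  rewrite [RHS](_ : _ = \tsum_(c, d <- R) \tsum_(e, f <- R) \tsum_(p, s <- R)
    (S a * (S d * f) * s) ⊗ (act W (e * c) (act W b w) ⊗ act M p m)); last first.
    rewrite [RHS]tlift_swap; apply: tlift_ext => e f; exact: tlift_swap.
  apply: tlift_ext => c d.
  rewrite (R_coprodl HR (F := fun e p y =>
    (S a * S d * y) ⊗ (act W (e * c) (act W b w) ⊗ act M p m))); last by lin.
  by apply: tlift_ext => e f; apply: tlift_ext => p s; rewrite !mulrA.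
rewrite /bar_rho; apply: tlift_ext => a b; rewrite [LHS](_ : _ =
   \tsum_(p, s <- R) \tsum_(e, f <- R) \tsum_(c, d <- R)
    (S a * (S d * f) * s) ⊗ (act W (e * c) (act W b w) ⊗ act M p m)); last exact: tlift_swap.
apply: tlift_ext => p s.
rewrite (R_Sl_inv_right HR (F := fun x y =>
   (S a * y * s) ⊗ (act W x (act W b w) ⊗ act M p m))); last by lin.
by rewrite mulr1 (act1 HW).
Qed.

Lemma bar_coact_pure w m : @coact _ _ bar (w ⊗ m) = bar_rho w m.
Proof. by rewrite bar_coactE tlift_pure // /bar_rho; lin. Qed.
Lemma bar_coact_linear : linear (@coact _ _ bar).
Proof.
have -> : @coact _ _ bar = tlift bar_rho by apply/funext => t; exact: bar_coactE.
by rewrite /bar_rho; lin.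
Qed.

(** W with the coaction w |-> S(a) ⊗ b w and M with m |-> d ⊗ c m are both
    Yetter-Drinfeld modules, and the coaction on W ⊗ M is their product.  Both sides
    are therefore brought to a sum over two copies of R for W and two for M. *)
Lemma bar_coactA (v : bar) :
    \tsum_(x, u <- coact v) \tsum_(x1, x2 <- Δ x) x1 ⊗ (x2 ⊗ u) =
    \tsum_(x, u <- coact v) x ⊗ coact u.
Proof.
move: v; apply: tensor_linear_ext => [||w m].
- have l := bar_coact_linear; lin.
- have l := bar_coact_linear; lin.
pose G x y p q : (H ⊗ (H ⊗ (W ⊗ M)))%type := x ⊗ (y ⊗ (act W p w ⊗ act M q m)).
transitivity (\tsum_(a, b <- R) \tsum_(a', b' <- R) \tsum_(c, d <- R) \tsum_(c', d' <- R)
  G (S a' * d') (S a * d) (b * b') (c * c')); last first.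
  transitivity (\tsum_(a', b' <- R) \tsum_(c', d' <- R) \tsum_(a, b <- R) \tsum_(c, d <- R)
    G (S a' * d') (S a * d) (b * b') (c * c')).
    rewrite [LHS]tlift_swap; apply: tlift_ext => a' b'.
    rewrite [RHS]tlift_swap; apply: tlift_ext => a b; exact: tlift_swap.
  have lc := bar_coact_linear; rewrite bar_coact_pure tlift_tlift; last by lin.
  apply: tlift_ext => a' b'; rewrite tlift_tlift; last by lin.
  apply: tlift_ext => c' d'; rewrite tlift_pure; last by lin.
  rewrite bar_coact_pure (tlift_push _ _ (pure_linearr _)); apply: tlift_ext => a b.
  rewrite (tlift_push _ _ (pure_linearr _)); apply: tlift_ext => c d.
  by rewrite /G (actM HW) (actM HM).
rewrite bar_coact_pure tlift_tlift; last by lin.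
transitivity (\tsum_(a, b <- R) \tsum_(p, q <- Δ (S a)) \tsum_(c, d <- R) \tsum_(r, s <- Δ d)
   G (p * r) (q * s) b c).
  apply: tlift_ext => a b; rewrite [RHS]tlift_swap tlift_tlift; last by lin.
  apply: tlift_ext => c d; rewrite tlift_pure; last by lin.
  by rewrite (coprodM_app A (F := fun x y => G x y b c)) //; rewrite /G; lin.
rewrite (R_inv_coprodl (F := fun p q b => \tsum_(c, d <- R) \tsum_(r, s <- Δ d)
   G (p * r) (q * s) b c)); last by rewrite /G; lin.
apply: tlift_ext => a b; apply: tlift_ext => a' b'.
by rewrite (R_coprodr HR (F := fun c r s => G (S a' * r) (S a * s) (b * b') c)) //; rewrite /G; lin.
Qed.

Lemma bar_counit (v : bar) : \tsum_(x, u <- coact v) ((ε x : k) *: u) = v.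
Proof.
move: v; apply: tensor_linear_ext => [||w m].
- have l := bar_coact_linear; lin.
- lin.
rewrite bar_coact_pure tlift_tlift; last by lin.
transitivity (\tsum_(a, b <- R) ((ε a : k) *: (act W b w ⊗ m))); last first.
  by rewrite (R_counitl_app HR (F := fun b => act W b w ⊗ m)) ?(act1 HW) //; lin.
apply: tlift_ext => a b; rewrite tlift_tlift; last by lin.
rewrite -{2}[m](act1 HM).
rewrite -(R_counitr_app HR (F := fun c => act W b w ⊗ act M c m)); last by lin.
rewrite (tlift_push _ _ (scale_linearr _)); apply: tlift_ext => c d.
rewrite tlift_pure; last by lin.
by rewrite scalerA counitM counit_antipode.
Qed.

(** The factor h on the left is moved past S(a) ⊗ b by [R_inv_intertwine], then
    past c ⊗ d by R Δ = Δ^op R. *)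
Lemma bar_compat h (v : bar) :
    \tsum_(h1, h2 <- Δ h) \tsum_(x, u <- coact v) (h1 * x) ⊗ act bar h2 u =
    \tsum_(h1, h2 <- Δ h) \tsum_(x, u <- coact (act bar h1 v)) (x * h2) ⊗ u.
Proof.
move: v; apply: tensor_linear_ext => [||w m].
- have l := bar_coact_linear; lin.
- have l := bar_coact_linear; lin.
pose G y p q : (H ⊗ (W ⊗ M))%type := y ⊗ (act W p w ⊗ act M q m).
have tG : trilinear G by rewrite /G; lin.
have lc := bar_coact_linear.
transitivity (\tsum_(a, b <- R) \tsum_(c, d <- R) \tsum_(h1, x <- Δ h) \tsum_(h2, h3 <- Δ x)
  G (h1 * S a * d) (h2 * b) (h3 * c)).
  rewrite bar_coact_pure.
  transitivity (\tsum_(h1, x <- Δ h) \tsum_(a, b <- R) \tsum_(c, d <- R) \tsum_(h2, h3 <- Δ x)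
    G (h1 * S a * d) (h2 * b) (h3 * c)).
    apply: tlift_ext => h1 x; rewrite tlift_tlift; last by lin.
    apply: tlift_ext => a b; rewrite tlift_tlift; last by lin.
    apply: tlift_ext => c d; rewrite tlift_pure; last by lin.
    rewrite /= tensor_act_pure (tlift_push _ _ (pure_linearr _)); apply: tlift_ext => h2 h3.
    by rewrite /G (actM HW) (actM HM) !mulrA.
  by rewrite tlift_swap; apply: tlift_ext => a b; rewrite tlift_swap.
transitivity (\tsum_(a, b <- R) \tsum_(c, d <- R) \tsum_(x, h3 <- Δ h) \tsum_(h1, h2 <- Δ x)
  G (S a * h2 * d) (b * h1) (h3 * c)).
  rewrite [LHS]tlift_swap [RHS]tlift_swap; apply: tlift_ext => c d.
  transitivity (\tsum_(a, b <- R) \tsum_(x, h3 <- Δ h) \tsum_(h1, h2 <- Δ x)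
     G (h1 * S a * d) (h2 * b) (h3 * c)).
    apply: tlift_ext => a b.
    by rewrite (coassoc A (F := fun h1 h2 h3 => G (h1 * S a * d) (h2 * b) (h3 * c))) //; lin.
  rewrite [LHS]tlift_swap [RHS]tlift_swap; apply: tlift_ext => x h3.
  by rewrite (R_inv_intertwine (F := fun p q => G (p * d) q (h3 * c))) //; lin.
transitivity (\tsum_(a, b <- R) \tsum_(c, d <- R) \tsum_(x, h3 <- Δ h) \tsum_(h1, h2 <- Δ x)
  G (S a * d * h3) (b * h1) (c * h2)).
  apply: tlift_ext => a b.
  transitivity (\tsum_(c, d <- R) \tsum_(h1, x <- Δ h) \tsum_(h2, h3 <- Δ x)
     G (S a * (h2 * d)) (b * h1) (h3 * c)).
    apply: tlift_ext => c d.
    rewrite (coassoc A (F := fun h1 h2 h3 => G (S a * h2 * d) (b * h1) (h3 * c))); last by lin.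
    by apply: tlift_ext => ? ?; apply: tlift_ext => ? ?; rewrite !mulrA.
  transitivity (\tsum_(c, d <- R) \tsum_(h1, x <- Δ h) \tsum_(h2, h3 <- Δ x)
     G (S a * (d * h3)) (b * h1) (c * h2)).
    rewrite [LHS]tlift_swap [RHS]tlift_swap; apply: tlift_ext => h1 x.
    by rewrite (R_intertwine HR x (F := fun p q => G (S a * q) (b * h1) p)) //; lin.
  apply: tlift_ext => c d.
  rewrite (coassoc A (F := fun h1 h2 h3 => G (S a * d * h3) (b * h1) (c * h2))); last by lin.
  by apply: tlift_ext => ? ?; apply: tlift_ext => ? ?; rewrite !mulrA.
transitivity (\tsum_(x, h3 <- Δ h) \tsum_(h1, h2 <- Δ x) \tsum_(a, b <- R) \tsum_(c, d <- R)
  G (S a * d * h3) (b * h1) (c * h2)).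
  rewrite [RHS](_ : _ = \tsum_(x, h3 <- Δ h) \tsum_(a, b <- R) \tsum_(c, d <- R)
     \tsum_(h1, h2 <- Δ x) G (S a * d * h3) (b * h1) (c * h2)).
    by rewrite [RHS]tlift_swap; apply: tlift_ext => a b; rewrite [RHS]tlift_swap.
  apply: tlift_ext => x h3; rewrite [LHS]tlift_swap; apply: tlift_ext => a b.
  exact: tlift_swap.
apply: tlift_ext => x h3.
rewrite (tensor_act_pure x w m : act bar x _ = _) (tlift_push _ _ lc) tlift_tlift; last by lin.
apply: tlift_ext => h1 h2; rewrite bar_coact_pure tlift_tlift; last by lin.
apply: tlift_ext => a b; rewrite tlift_tlift; last by lin.
apply: tlift_ext => c d; rewrite tlift_pure; last by lin.
by rewrite /G (actM HW) (actM HM).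
Qed.

Lemma bar_is_module : is_module (tensor_module A W M).
Proof.
split=> [v|v|g h v] /=.
- rewrite /tensor_act; lin.
- by rewrite /tensor_act coprod1 tlift_pure; last (by lin);
   rewrite -[RHS]tlift_id; apply: tlift_ext => w m; rewrite (act1 HW) (act1 HM).
move: v; apply: tensor_linear_ext => [||w m].
- rewrite /tensor_act; lin.
- exact: (@comp_linear _ _ _ _ (tensor_act A g) (tensor_act A h)) (linearP _) (linearP _).
rewrite !tensor_act_pure coprodM_app; last by lin.
rewrite (tlift_push _ _ (linearP (tensor_act A g))) [LHS]tlift_swap; apply: tlift_ext => c d.
rewrite /= tensor_act_pure; apply: tlift_ext => a b; by rewrite (actM HW) (actM HM).
Qed.

Lemma bar_is_yd : is_yd A bar.
Proof.
split.
- exact: bar_is_module.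
- exact: bar_coact_linear.
- exact: bar_coactA.
- exact: bar_counit.
- exact: bar_compat.
Qed.

End BarTensor.
End Bar.

(** * Yetter-Drinfeld modules as modules over H ⊗ H *)

Lemma linfun_linear (k : fieldType) (U V : vectType k) (f : U -> V) :
  linear f -> linfun f =1 f.
Proof.
by move=> lf; exact: (lfunE (bundle_linear lf)).
Qed.

Section DoubleAction.
Variables (k : fieldType) (H : falgType k) (A : hopf_algebra H).
Local Notation Δ := (coprod A).
Local Notation S := (antipode A).
Local Notation ε := (counit A).
Local Notation HH := (H ⊗ H)%type.

(** For X = p(-) h this is the operator v |-> p(v_{-1}) h v_0, a product of an
    element of the dual of H with an element of H in the Drinfeld double. *)
Definition end_act (V : yd_data H) (X : 'End(H)) (v : V) : V :=
  \tsum_(y, u <- coact v) act V (X y) u.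

(** The product of the Drinfeld double: X after Y, with the element Y(y) of H moved
    to the left of the functional part of X by means of
    (h v)_{-1} ⊗ (h v)_0 = h1 v_{-1} S(h3) ⊗ h2 v_0. *)
Definition end_comp_fun (X Y : 'End(H)) (t : H) : H :=
  \tsum_(y, z <- Δ t) \tsum_(h1, x <- Δ (Y y)) \tsum_(h2, h3 <- Δ x)
    (X (h1 * z * S h3) * h2).
Definition end_comp (X Y : 'End(H)) : 'End(H) := linfun (end_comp_fun X Y).

Lemma end_compE X Y t : end_comp X Y t = end_comp_fun X Y t.
Proof. by apply: linfun_linear; rewrite /end_comp_fun; lin. Qed.

Section YD.
Variables (V : yd_data H) (HV : is_yd A V).
Let Vm := yd_module HV.
Let Vc := coact_linear HV.

Lemma coactA_app (Z : lmodType k) (F : H -> H -> V -> Z) v : trilinear F ->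
  \tsum_(x, u <- coact v) \tsum_(x1, x2 <- Δ x) F x1 x2 u =
  \tsum_(x, u <- coact v) \tsum_(y, w <- coact u) F x y w.
Proof.
move=> tF; have lF := trilift_linear tF; have := congr1 (trilift F) (coactA HV v).
rewrite !(tlift_push _ _ lF) => e.
etransitivity; last (etransitivity; first exact: e).
  apply: tlift_ext => a b; rewrite (tlift_push _ _ lF).
  by apply: tlift_ext => c d; rewrite trilift_pure3.
by apply: tlift_ext => a b; rewrite trilift_pure.
Qed.

Lemma yd_compat_app (Z : lmodType k) (F : H -> V -> Z) h v : bilinear_map F ->
  \tsum_(h1, h2 <- Δ h) \tsum_(x, u <- coact v) F (h1 * x) (act V h2 u) =
  \tsum_(h1, h2 <- Δ h) \tsum_(x, u <- coact (act V h1 v)) F (x * h2) u.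
Proof.
move=> bF; have lF := tlift_linear bF; have := congr1 (tlift F) (yd_compat HV h v).
rewrite !(tlift_push _ _ lF) => e.
etransitivity; last (etransitivity; first exact: e).
  apply: tlift_ext => a b; rewrite (tlift_push _ _ lF).
  by apply: tlift_ext => c d; rewrite tlift_pure.
apply: tlift_ext => a b; rewrite (tlift_push _ _ lF).
by apply: tlift_ext => c d; rewrite tlift_pure.
Qed.

(** Multiply the compatibility axiom by S(h3) on the right. *)
Lemma coact_act_app (Z : lmodType k) (F : H -> V -> Z) h v : bilinear_map F ->
  \tsum_(x, u <- coact (act V h v)) F x u =
  \tsum_(h1, x <- Δ h) \tsum_(h2, h3 <- Δ x) \tsum_(y, u <- coact v)
     F (h1 * y * S h3) (act V h2 u).
Proof.
move=> bF.
rewrite -(coassoc A (F := fun h1 h2 h3 => \tsum_(y, u <- coact v)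
     F (h1 * y * S h3) (act V h2 u))); last by lin.
transitivity (\tsum_(x, h3 <- Δ h) \tsum_(h1, h2 <- Δ x) \tsum_(y, u <- coact (act V h1 v))
   F (y * h2 * S h3) u); last first.
  apply: tlift_ext => x h3; symmetry.
  by apply: (yd_compat_app (F := fun z u => F (z * S h3) u)); lin.
rewrite (coassoc A (F := fun h1 h2 h3 => \tsum_(y, u <- coact (act V h1 v))
     F (y * h2 * S h3) u)); last by lin.
rewrite -(counitr_app A (F := fun h => \tsum_(x, u <- coact (act V h v)) F x u)); last by lin.
apply: tlift_ext => h1 x.
rewrite -[X in ε x *: X](_ : \tsum_(y, u <- coact (act V h1 v)) F (y * 1) u = _); last first.
  by apply: tlift_ext => y u; rewrite mulr1.
rewrite -(antipoder_app A (F := fun z =>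
  \tsum_(y, u <- coact (act V h1 v)) F (y * z) u)); last by lin.
by apply: tlift_ext => ? ?; apply: tlift_ext => ? ?; rewrite mulrA.
Qed.

Lemma end_act_linear X : linear (@end_act V X).
Proof. by rewrite /end_act; lin. Qed.

Lemma end_act_linearl v : linear (fun X => @end_act V X v).
Proof.
move=> c X Y; rewrite /end_act /tlift /formal_sum scaler_sumr -big_split /=.
apply: eq_bigr => i _; rewrite !lfunE /= lfunE /= .
exact: (act_linear Vm).
Qed.

Lemma end_actM X Y (v : V) : end_act (end_comp X Y) v = end_act X (end_act Y v).
Proof.
transitivity (\tsum_(t, w <- coact v) \tsum_(y, z <- Δ t)
  \tsum_(h1, x <- Δ (Y y)) \tsum_(h2, h3 <- Δ x)
  act V (X (h1 * z * S h3) * h2) w).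
  apply: tlift_ext => t w; rewrite end_compE /end_comp_fun (tlift_push _ _ (act_linear Vm _)).
  apply: tlift_ext => ? ?; rewrite (tlift_push _ _ (act_linear Vm _)).
  by apply: tlift_ext => ? ?; rewrite (tlift_push _ _ (act_linear Vm _)).
rewrite (coactA_app (F := fun y z w => \tsum_(h1, x <- Δ (Y y)) \tsum_(h2, h3 <- Δ x)
  act V (X (h1 * z * S h3) * h2) w)); last by lin.
rewrite {2}/end_act (tlift_push _ _ (end_act_linear X)); apply: tlift_ext => y u.
rewrite {1}/end_act (coact_act_app (F := fun x u => act V (X x) u)); last by lin.
rewrite tlift_swap; apply: tlift_ext => h1 x.
rewrite tlift_swap; apply: tlift_ext => h2 h3.
by apply: tlift_ext => z w; rewrite (actM Vm).
Qed.

(** The element h of the Drinfeld double. *)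
Definition counit_end (h : H) : 'End(H) := linfun (fun x => (ε x : k) *: h).

Lemma counit_endE h x : counit_end h x = (ε x : k) *: h.
Proof. by apply: linfun_linear; lin. Qed.

Lemma end_act_counit h (v : V) : end_act (counit_end h) v = act V h v.
Proof.
rewrite -[in RHS](coact_counit HV v) (tlift_push _ _ (linearP _)).
by apply: tlift_ext => x u; rewrite linearZ counit_endE;
   exact: (linear_scale _ _ (act_linear Vm u)).
Qed.

End YD.

Definition lmul (h x : H) : H := h * x.
Lemma lmul_linear h : linear (lmul h).
Proof. by rewrite /lmul; lin. Qed.
HB.instance Definition _ h := GRing.isLinear.Build k H H *:%R (lmul h) (lmul_linear h).
Definition regular_module : module_data H := ModuleData (fun h => lmul h : {linear _ -> _}).

Lemma regular_is_module : is_module regular_module.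
Proof.
split=> [v|v|g h v] /=; rewrite /lmul ?mul1r ?mulrA //; lin.
Qed.

Variable R : HH.
Hypothesis HR : quasi_triangular A R.

(** The element through which X acts on W ⊗ M: in terms of the Drinfeld double, its
    homomorphism to H ⊗ H given by R and its inverse. *)
Definition double_map (X : 'End(H)) : HH :=
  \tsum_(a, b <- R) \tsum_(c, d <- R) \tsum_(h1, h2 <- Δ (X (S a * d))) (h1 * b) ⊗ (h2 * c).

Definition outer_act (W M : module_data H) (t : HH) (u : (W ⊗ M)%type) : (W ⊗ M)%type :=
  \tsum_(x, y <- t) \tsum_(w, m <- u) act W x w ⊗ act M y m.

Lemma outer_act_pure (W M : module_data H) t (w : W) (m : M) :
  outer_act t (w ⊗ m) = \tsum_(x, y <- t) act W x w ⊗ act M y m.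
Proof. by apply: tlift_ext => x y; rewrite tlift_pure //; lin. Qed.

Lemma outer_act_linear (W M : module_data H) t : linear (@outer_act W M t).
Proof. by rewrite /outer_act; lin. Qed.

Lemma outer_act_linearl (W M : module_data H) u : is_module W -> is_module M ->
  linear (fun t => @outer_act W M t u).
Proof. by move=> HW HM; rewrite /outer_act; lin. Qed.

Lemma outer_act_pure2 (W M : module_data H) x y (w : W) (m : M) :
  is_module W -> is_module M -> outer_act (x ⊗ y) (w ⊗ m) = act W x w ⊗ act M y m.
Proof. by move=> HW HM; rewrite outer_act_pure tlift_pure //; lin. Qed.

Lemma end_act_bar W M (HW : is_module W) (HM : is_module M) X (u : bar_tensor A R W M) :
  end_act X u = outer_act (double_map X) u.
Proof.
have HB := bar_is_yd HR HW HM.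
move: u; apply: tensor_linear_ext => [||w m].
- exact: (end_act_linear HB).
- exact: outer_act_linear.
rewrite /end_act (bar_coact_pure HR) // tlift_tlift; last first.
  have l := yd_module HB; lin.
rewrite outer_act_pure /double_map tlift_tlift; last by lin.
apply: tlift_ext => a b; rewrite !tlift_tlift; last first.
- have l := yd_module HB; lin.
- lin.
apply: tlift_ext => c d; rewrite tlift_pure; last first.
  have l := yd_module HB; lin.
rewrite tlift_tlift; last by lin.
rewrite /= tensor_act_pure; apply: tlift_ext => h1 h2.
by rewrite tlift_pure ?(actM HW) ?(actM HM) //; lin.
Qed.

Local Notation Hbar := (bar_tensor A R regular_module regular_module).

Lemma outer_act_regular s t : outer_act (W := regular_module) (M := regular_module) s t = tmul s t.
Proof. by []. Qed.

Lemma double_mapE X : double_map X = end_act X (1 ⊗ 1 : Hbar).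
Proof.
by rewrite (end_act_bar regular_is_module regular_is_module) outer_act_regular tmul1r.
Qed.

Lemma double_map_linear : linear double_map.
Proof.
move=> c X Y; rewrite !double_mapE.
exact: (end_act_linearl (bar_is_yd HR regular_is_module regular_is_module)).
Qed.

(** H ⊗ H acts faithfully on itself, and [end_actM] holds on the object attached to
    two copies of H. *)
Lemma double_mapM X Y : double_map (end_comp X Y) = tmul (double_map X) (double_map Y).
Proof.
have HB := bar_is_yd HR regular_is_module regular_is_module.
by rewrite [LHS]double_mapE (end_actM HB) !(end_act_bar regular_is_module regular_is_module)
   !outer_act_regular tmul1r.
Qed.

Lemma double_map_counit_end h : double_map (counit_end h) = Δ h.
Proof.
have HB := bar_is_yd HR regular_is_module regular_is_module.
by rewrite double_mapE (end_act_counit HB) /= tensor_act_pure /= /lmul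
  -[RHS]tlift_id; apply: tlift_ext => a b; rewrite !mulr1.
Qed.

(** The bijection u ⊗ h |-> h1 u ⊗ h2; it accounts for the fact that h acts on
    W ⊗ M through Δ(h). *)
Definition galois_map (u h : H) : HH := \tsum_(h1, h2 <- Δ h) (h1 * u) ⊗ h2.
Definition galois_inv (t : HH) : HH :=
  \tsum_(u, h <- t) \tsum_(h1, h2 <- Δ h) (antipode_inv A h1 * u) ⊗ h2.

(** This passes from the Yetter-Drinfeld coaction to the coaction ρ_R: X acts by
    v |-> X'(v^{-1}) v^0, for X' the twist of X. *)
Definition R_twist (X : 'End(H)) : 'End(H) := linfun (fun y => \tsum_(e, f <- R) (X (y * f) * e)).
Lemma R_twistE X y : R_twist X y = \tsum_(e, f <- R) (X (y * f) * e).
Proof. by apply: linfun_linear; lin. Qed.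

(** Evaluate at 1 ⊗ 1 with the coaction ρ_R instead of its simplified
    Yetter-Drinfeld form, so that the tensor c b ⊗ d a defining the Drinfeld map
    appears. *)
Lemma double_map_galois X : double_map X =
  \tsum_(a, b <- R) \tsum_(c, d <- R) galois_map (c * b) (R_twist X (S (d * a))).
Proof.
have HB := bar_is_yd HR regular_is_module regular_is_module.
rewrite double_mapE /end_act.
have lt : forall v : HH, linear (fun h => @tensor_act k H A regular_module regular_module h v).
  exact: (act_linear (yd_module HB)).
rewrite /= /bar_coactR tlift_pure; last by lin.
rewrite tlift_tlift; last by lin.
rewrite tlift_tlift; last by lin.
apply: tlift_ext => a b; rewrite tlift_tlift; last by lin.
apply: tlift_ext => c d; rewrite tlift_pure; last by lin.
rewrite tlift_tlift; last by lin.
transitivity (@tensor_act k H A regular_module regular_module (R_twist X (S (d * a)))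
   ((c * b : H) ⊗ (1 : H))).
  rewrite R_twistE (tlift_push _ _ (lt _)); apply: tlift_ext => e f.
  rewrite tlift_pure; last by lin.
  by rewrite [RHS](actM (yd_module HB)) /= /lmul mulr1.
rewrite tensor_act_pure; apply: tlift_ext => h1 h2; by rewrite /= /lmul mulr1.
Qed.

Lemma R_twist_inv (X : 'End(H)) y : X y = \tsum_(c, d <- R) (R_twist X (y * S d) * c).
Proof.
transitivity (\tsum_(a, b <- R) \tsum_(c, d <- R) (X (y * (S d * b)) * (a * c))).
  by rewrite (R_Sl_inv_right HR (F := fun p q => X (y * q) * p)) ?mulr1 //; lin.
rewrite tlift_swap; apply: tlift_ext => c d; rewrite R_twistE (tlift_push _ _ (mul_linearl _)).
by apply: tlift_ext => a b; rewrite !mulrA.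
Qed.

Lemma galois_map_bilinear : bilinear_map galois_map. Proof. by rewrite /galois_map; lin. Qed.

Hypothesis Hfact : factorizable R.

Lemma galois_mapK u h : galois_inv (galois_map u h) = u ⊗ h.
Proof.
have lSi := antipode_inv_linear A.
rewrite /galois_inv /galois_map tlift_tlift; last by lin.
transitivity (\tsum_(x, q <- Δ h) \tsum_(h1, p <- Δ x) (antipode_inv A p * h1 * u) ⊗ q).
  rewrite (coassoc A (F := fun h1 p q => (antipode_inv A p * h1 * u) ⊗ q)); last by lin.
  apply: tlift_ext => h1 h2; rewrite tlift_pure; last by lin.
  by do 1!apply: tlift_ext => p q; rewrite mulrA.
rewrite -(counitl_app A (F := fun q => u ⊗ q)); last by lin.
apply: tlift_ext => x q.
by rewrite (antipode_invl_app HR Hfact (F := fun z => (z * u) ⊗ q)) ?mul1r //; lin.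
Qed.

Lemma galois_invK t : tlift galois_map (galois_inv t) = t.
Proof.
have lSi := antipode_inv_linear A; have bg := galois_map_bilinear.
move: t; apply: tensor_linear_ext => [||u h]; [rewrite /galois_inv; lin | lin|].
rewrite /galois_inv tlift_pure; last by lin.
rewrite tlift_tlift //.
transitivity (\tsum_(x, q <- Δ h) \tsum_(h1, p <- Δ x) (p * antipode_inv A h1 * u) ⊗ q).
  rewrite (coassoc A (F := fun h1 p q => (p * antipode_inv A h1 * u) ⊗ q)); last by lin.
  apply: tlift_ext => h1 h2; rewrite tlift_pure; last by lin.
  by apply: tlift_ext => p q; rewrite mulrA.
rewrite -(counitl_app A (F := fun q => u ⊗ q)); last by lin.
apply: tlift_ext => x q.
by rewrite (antipode_invr_app HR Hfact (F := fun z => (z * u) ⊗ q)) ?mul1r //; lin.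
Qed.

Definition dual_of_linear (V : lmodType k) (f : V -> k^o) (lf : linear f) : dual V :=
  @Dual k V f (asboolT lf).

Lemma drinfeld_swap (p : dual H) :
  drinfeld_map R p = \tsum_(a, b <- R) \tsum_(c, d <- R) ((p (d * a) : k) *: (c * b)).
Proof. exact: tlift_swap. Qed.

Lemma drinfeld0 (p : dual H) : drinfeld_map R p = 0 -> p = 0.
Proof.
move=> e; apply: (bij_inj Hfact); rewrite e /drinfeld_map /tlift /formal_sum.
by rewrite big1 // => i _; rewrite big1 // => j _; rewrite [X in X *: _](_ : _ = 0) ?scale0r.
Qed.

(** Applying a linear form f to the leg carrying the values of X shows that the
    Drinfeld map kills f o X' o S, for X' the twist of X.  So X' o S vanishes, and X
    with it. *)
Lemma double_map_eq0 X : double_map X = 0 -> X = 0.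
Proof.
move=> e.
have lSi := antipode_inv_linear A.
have lu : linear galois_inv by rewrite /galois_inv; lin.
have e1 : \tsum_(a, b <- R) \tsum_(c, d <- R) (c * b) ⊗ R_twist X (S (d * a)) = 0 :> HH.
  rewrite -[RHS](_ : galois_inv (double_map X) = 0).
    rewrite double_map_galois (tlift_push _ _ lu); apply: tlift_ext => a b.
    by rewrite (tlift_push _ _ lu); apply: tlift_ext => c d; rewrite galois_mapK.
  by rewrite e; exact: (linear_zero lu).
have e2 : R_twist X = 0.
  apply/lfunP => z; have [y <-] := antipode_surj HR Hfact z; rewrite [RHS]lfunE /=.
  rewrite (coord_vbasis (memvf (R_twist X (S y)))) big1 // => i _.
  have lc : linear (coord (vbasis (@fullv k H)) i : H -> k^o) by exact: linearP.
  pose f (y : H) : k^o := coord (vbasis fullv) i (R_twist X (S y)).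
  have lf : linear f by refine (@comp_linear k H H k^o _ (fun y => R_twist X (S y)) lc _); lin.
  suff p0 : dual_of_linear lf = 0.
    have fy : f y = 0 := congr1 (fun p : dual H => p y) p0.
    by rewrite -[coord _ _ _]/(f y) fy scale0r.
  apply: drinfeld0; rewrite drinfeld_swap.
  have /(congr1 (tlift (fun u h : H => (coord (vbasis fullv) i h : k) *: u))) := e1.
  have bl : bilinear_map (fun u h : H => (coord (vbasis fullv) i h : k) *: u) by lin.
  rewrite tlift_tlift //.
  rewrite [X in _ = X -> _](_ : _ = 0); last first.
    exact: (linear_zero (tlift_linear bl)).
  move=> <-; apply: tlift_ext => a b; rewrite tlift_tlift //; apply: tlift_ext => c d.
  by rewrite tlift_pure.
apply/lfunP => y; rewrite R_twist_inv e2 [RHS]lfunE /= /tlift /formal_sum big1 // => j _.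
by rewrite lfunE /= mul0r.
Qed.

(** If the Drinfeld map sends p to u, the X whose twist is y |-> p(S^{-1}(y)) h is a
    preimage. *)
Lemma galois_map_in_range u h : exists X, double_map X = galois_map u h.
Proof.
have lSi := antipode_inv_linear A.
have [psi _ psiK] := Hfact; pose p := psi u.
pose X : 'End(H) := linfun (fun y =>
  \tsum_(e, f <- R) ((p (antipode_inv A (y * S f)) : k) *: (h * e))).
have XE y : X y = \tsum_(e, f <- R) ((p (antipode_inv A (y * S f)) : k) *: (h * e)).
  by apply: linfun_linear; lin.
have tX y : R_twist X y = (p (antipode_inv A y) : k) *: h.
  rewrite R_twistE.
  transitivity (\tsum_(a, b <- R) \tsum_(c, d <- R)
      ((p (antipode_inv A (y * (d * S b))) : k) *: (h * (a * c)))); last first.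
    by rewrite (R_Sr_inv_right HR (F := fun x z => (p (antipode_inv A (y * z)) : k) *: (h * x)))
        ?mulr1 //; lin.
  rewrite [RHS]tlift_swap; apply: tlift_ext => a b.
  rewrite XE (tlift_push _ _ (mul_linearl _)); apply: tlift_ext => c d.
  by rewrite -scalerAl !mulrA.
exists X; rewrite double_map_galois -[in RHS](psiK u) -/p drinfeld_swap.
rewrite (tlift_push _ _ (bilinear_left galois_map_bilinear _)); apply: tlift_ext => a b.
rewrite (tlift_push _ _ (bilinear_left galois_map_bilinear _)); apply: tlift_ext => c d.
rewrite tX (antipode_invK HR Hfact) (linear_scale _ _ (bilinear_left galois_map_bilinear _)).
exact: (linear_scale _ _ (bilinear_right galois_map_bilinear _)).
Qed.

Lemma double_map_surj t : exists X, double_map X = t.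
Proof.
rewrite -(galois_invK t) /tlift /formal_sum; elim: (repr _) => [|x s [Y eY]].
  exists 0; rewrite big_nil; exact: (linear_zero double_map_linear).
have [X eX] := galois_map_in_range x.1 x.2; exists (X + Y); rewrite big_cons -eX -eY.
by have := double_map_linear 1 X Y; rewrite !scale1r.
Qed.

Definition double_inv (t : HH) : 'End(H) := projT1 (cid (double_map_surj t)).
Lemma double_invK t : double_map (double_inv t) = t.
Proof. exact: projT2 (cid (double_map_surj t)). Qed.

Lemma double_map_inj : injective double_map.
Proof.
move=> X Y e; apply/eqP; rewrite -subr_eq0; apply/eqP/double_map_eq0.
have := double_map_linear (-1) Y X; rewrite !scaleN1r [- Y + X]addrC => ->.
by rewrite e addNr.
Qed.

Lemma double_mapK X : double_inv (double_map X) = X.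
Proof. by apply: double_map_inj; rewrite double_invK. Qed.

Lemma double_inv_linear : linear double_inv.
Proof. by move=> c s t; apply: double_map_inj; rewrite double_map_linear !double_invK. Qed.

Lemma double_invM s t : double_inv (tmul s t) = end_comp (double_inv s) (double_inv t).
Proof. by apply: double_map_inj; rewrite double_mapM !double_invK. Qed.

(** So the H-action on a Yetter-Drinfeld module is the action of Δ(H). *)
Lemma double_inv_coprod h : double_inv (Δ h) = counit_end h.
Proof. by apply: double_map_inj; rewrite double_map_counit_end double_invK. Qed.

Definition hh_act (V : yd_data H) (t : HH) (v : V) : V := end_act (double_inv t) v.

Section TactYD.
Variables (V : yd_data H) (HV : is_yd A V).

Lemma hh_act_linearl (v : V) : linear (fun t => hh_act t v).
Proof.
exact: (comp_linear (g := fun X => @end_act V X v)) (end_act_linearl HV v) double_inv_linear.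
Qed.
Lemma hh_act_linearr t : linear (@hh_act V t).
Proof. exact: end_act_linear. Qed.
Lemma hh_actM s t (v : V) : hh_act (tmul s t) v = hh_act s (hh_act t v).
Proof. by rewrite /hh_act double_invM (end_actM HV). Qed.
Lemma hh_act_coprod h (v : V) : hh_act (Δ h) v = act V h v.
Proof. by rewrite /hh_act double_inv_coprod (end_act_counit HV). Qed.
Lemma hh_act1 (v : V) : hh_act (1 ⊗ 1) v = v.
Proof. by rewrite -(coprod1 A) hh_act_coprod (act1 (yd_module HV)). Qed.
Lemma end_actE X (v : V) : end_act X v = hh_act (double_map X) v.
Proof. by rewrite /hh_act double_mapK. Qed.
End TactYD.

Lemma hh_act_bar W M (HW : is_module W) (HM : is_module M) t (u : bar_tensor A R W M) :
  hh_act t u = outer_act t u.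
Proof. by rewrite /hh_act (end_act_bar HW HM) double_invK. Qed.

End DoubleAction.

(** * Minimal left ideals and simple modules *)

Section Subspaces.
Variables (k : fieldType) (H : vectType k).

(** A subspace contained in P that is not all of P can be enlarged, and the dimension
    is bounded. *)
Lemma subspace_vspace (P : H -> Prop) :
  P 0 -> (forall c x y, P x -> P y -> P (c *: x + y)) ->
  exists U : {vspace H}, forall x, x \in U <-> P x.
Proof.
move=> P0 PD.
suff ext n (U : {vspace H}) : (\dim {:H} - \dim U <= n)%N -> (forall x, x \in U -> P x) ->
    exists U : {vspace H}, forall x, x \in U <-> P x.
  by apply: (ext _ 0%VS (leqnn _)) => x; rewrite memv0 => /eqP->.
elim: n U => [|n IH] U le_n UP.
  exists U => x; split; first exact: UP.
  move: le_n; rewrite leqn0 subn_eq0 => le.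
  have -> : U = fullv by apply/eqP; rewrite eqEdim subvf.
  by rewrite memvf.
have [all_in|/existsNP [x /not_implyP [Px /negP xU]]] := pselect (forall x, P x -> x \in U).
  by exists U => x; split; [exact: UP|exact: all_in].
apply: (IH (U + <[x]>)%VS).
  have -> : \dim (U + <[x]>) = (\dim U).+1.
    rewrite dimv_disjoint_sum ?dim_vline; last first.
      apply/eqP; rewrite -subv0; apply/subvP => y.
      rewrite memv_cap => /andP [yU /vlineP [c yc]].
      rewrite memv0 yc scaler_eq0; apply/orP; left; apply: contraR xU => c0.
      by rewrite -[x](scalerK c0) memvZ // -yc.
    have -> : x != 0 by apply: contraNneq xU => ->; rewrite mem0v.
    by rewrite addn1.
  by rewrite subnS; move: le_n; case: (\dim _ - \dim _)%N.
move=> y /memv_addP [u uU [_ /vlineP [c ->] ->]].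
by rewrite addrC; apply: PD => //; exact: UP.
Qed.

End Subspaces.

Section Ideals.
Variables (k : fieldType) (H : falgType k).

Definition left_ideal (J : {vspace H}) := (fullv * J <= J)%VS.

Lemma left_idealP (J : {vspace H}) : reflect (forall h x, x \in J -> h * x \in J) (left_ideal J).
Proof.
apply: (iffP prodvP) => [id h x|id h x _]; last exact: id.
by apply: id; rewrite memvf.
Qed.

Definition minimal_left_ideal (J : {vspace H}) : Prop :=
  [/\ left_ideal J, J <> 0%VS
    & forall N : {vspace H}, left_ideal N -> (N <= J)%VS -> N = 0%VS \/ N = J].

Hypothesis Hss : semisimple H.

(** A left ideal minimal among those on which f does not vanish is minimal among all
    nonzero ones: f vanishes on each of its proper left subideals N, hence not on a
    complement of N. *)
Lemma minimal_left_ideal_exists (V : lmodType k) (f : H -> V) (h : H) :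
  linear f -> f h <> 0 ->
  exists2 J : {vspace H}, minimal_left_ideal J & exists2 j, j \in J & f j <> 0.
Proof.
move=> lf fh.
suff ext n (J : {vspace H}) : (\dim J <= n)%N -> left_ideal J ->
    (exists2 j, j \in J & f j <> 0) ->
    exists2 J : {vspace H}, minimal_left_ideal J & exists2 j, j \in J & f j <> 0.
  apply: (ext _ fullv (leqnn _)); first exact: subvf.
  by exists h; rewrite ?memvf.
elim: n J => [|n IH] J le_n Ji [j jJ fj].
  case: fj; move: le_n; rewrite leqn0 dimv_eq0 => /eqP J0.
  move: jJ; rewrite J0 memv0 => /eqP ->.
  exact: (linear_zero lf).
have [[N [Ni NJ NnJ fN]]|noN] := pselect (exists N : {vspace H},
    [/\ left_ideal N, (N <= J)%VS, N <> J & exists2 j, j \in N & f j <> 0]).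
  apply: (IH N) => //; rewrite -ltnS; apply: leq_trans le_n.
  rewrite ltn_neqAle dimvS // andbT; apply/eqP => e; apply: NnJ.
  by apply/eqP; rewrite eqEdim NJ e leqnn.
exists J; last by exists j.
split=> // [J0|N Ni NJ].
  by case: fj; move: jJ; rewrite J0 memv0 => /eqP ->; exact: (linear_zero lf).
have [->|NnJ] := pselect (N = J); [by right|left].
have [N' [N'i sN' cN']] := Hss Ni.
have N'J : left_ideal (N' :&: J)%VS.
  apply/left_idealP => g x; rewrite !memv_cap => /andP [x1 x2].
  by rewrite (left_idealP _ N'i) // (left_idealP _ Ji).
have fN x : x \in N -> f x = 0.
  by move=> xN; apply: contrapT => fx; apply: noN; exists N; split=> //; exists x.
have [a aN [b bN' e]] : exists2 a, a \in N & exists2 b, b \in N' & j = a + b.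
  by apply/memv_addP; rewrite sN' memvf.
have bJ : b \in (N' :&: J)%VS.
  rewrite memv_cap bN' /=; have -> : b = j - a by rewrite e addrC addKr.
  by rewrite memvB // (subvP NJ).
have fb : f b <> 0.
  move=> fb; apply: fj; rewrite e -[a]scale1r lf fb fN // scaler0.
  by rewrite addr0.
have eJ : (N' :&: J)%VS = J.
  apply: contrapT => ne; apply: noN; exists (N' :&: J)%VS; split=> //; first exact: capvSr.
  by exists b.
apply/eqP; rewrite -subv0 -cN' subv_cap subvv /=.
by apply: subv_trans NJ _; rewrite -eJ capvSl.
Qed.

Definition ideal_module (J : {vspace H}) : module_data H :=
  ModuleData (fun h => vsproj J \o lmul h \o vsval : {linear _ -> _}).

Lemma ideal_actE J h (x : ideal_module J) : left_ideal J ->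
  vsval (act (ideal_module J) h x) = h * vsval x.
Proof. by move=> Ji; rewrite /= vsprojK //; apply: (left_idealP _ Ji); exact: subvsP. Qed.

Lemma ideal_module_simple J : minimal_left_ideal J -> simple_module (ideal_module J).
Proof.
case=> Ji J0 Jmin; have aE := ideal_actE _ _ Ji; split.
- split=> [v c g h|v|g h v]; apply: subvs_inj.
  + rewrite [RHS](linearP (@vsval k H J)) /=.
    by rewrite [RHS](congr2 (fun a b => c *: a + b) (aE g v) (aE h v)) aE mulrDl -scalerAl.
  + by rewrite aE mul1r.
  + by rewrite !aE mulrA.
- have [x xJ x0] : exists2 x, x \in J & x != 0.
    by exists (vpick J); rewrite ?memv_pick // vpick0; apply/eqP.
  exists (vsproj J x); apply: contraNneq x0 => /(congr1 vsval) /=.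
  by rewrite vsprojK // => ->; rewrite ?linear0 ?eqxx.
move=> U [[U0 UD] Uact].
have [N NE] : exists N : {vspace H}, forall x, x \in N <-> x \in J /\ vsproj J x \in U.
  apply: subspace_vspace => [|c x y [xJ xU] [yJ yU]].
    by rewrite mem0v linear0.
  by rewrite memvD ?memvZ // linearP UD.
have Ni : left_ideal N.
  apply/left_idealP => h x /NE [xJ xU]; apply/NE; split; first exact: (left_idealP _ Ji).
  have -> : vsproj J (h * x) = act (ideal_module J) h (vsproj J x) by rewrite /= vsprojK.
  exact: Uact.
have NJ : (N <= J)%VS by apply/subvP => x /NE [].
have [N0|eN] := Jmin N Ni NJ.
  left=> v vU; apply: val_inj; apply/eqP; rewrite linear0 -memv0 -N0; apply/NE.
  by rewrite subvsP vsvalK.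
right=> v; have : vsval v \in N by rewrite eN; exact: subvsP.
by move=> /NE [_]; rewrite vsvalK.
Qed.

End Ideals.

Section SimpleModules.
Variables (k : fieldType) (H : falgType k).

Lemma act0 (V : module_data H) (v : V) : is_module V -> act V 0 v = 0.
Proof. by move=> HV; exact: (linear_zero (act_linear HV v)). Qed.

Lemma simple_cyclic (W : module_data H) (w x : W) :
  simple_module W -> w <> 0 -> exists h, act W h w = x.
Proof.
case=> HW _ Wmin w0.
pose U : {pred W} := fun x => `[< exists h, act W h w = x >].
have Ust : stable U.
  split; first split.
  - by apply/asboolP; exists 0; rewrite act0.
  - move=> c u v /asboolP [g <-] /asboolP [h <-]; apply/asboolP; exists (c *: g + h).
    by rewrite (act_linear HW).
  by move=> g u /asboolP [h <-]; apply/asboolP; exists (g * h); rewrite (actM HW).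
case: (Wmin U Ust) => [U0|Uall]; last exact/asboolP/Uall.
by case: w0; apply: U0; apply/asboolP; exists 1; rewrite (act1 HW).
Qed.

(** M is a quotient of H: the basis of H is pushed along h |-> h m0, and its
    coordinate forms are pulled back along a linear section. *)
Lemma simple_frame (M : module_data H) : simple_module M ->
  exists s : seq (M * dual M), forall x, \sum_(i <- s) (i.2 x : k) *: i.1 = x.
Proof.
move=> sM; have [HM [m0 /eqP m0N] _] := sM.
have [K KE] : exists K : {vspace H}, forall h, h \in K <-> act M h m0 = 0.
  apply: subspace_vspace => [|c g h eg eh]; first by rewrite act0.
  by rewrite (act_linear HM) eg eh scaler0 addr0.
have lift x : exists h, h \in (K^C)%VS /\ act M h m0 = x.
  have [h <-] := simple_cyclic x sM m0N.
  have /memv_addP [a aK [b bC ->]] : h \in (K + K^C)%VS by rewrite addv_complf memvf.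
  by exists b; rewrite -[a]scale1r (act_linear HM) (KE a).1 // scaler0 add0r.
pose g x := projT1 (cid (lift x)).
have gC x : g x \in (K^C)%VS by case: (projT2 (cid (lift x))).
have gE x : act M (g x) m0 = x by case: (projT2 (cid (lift x))).
have gl : linear g.
  move=> c x y; apply/eqP; rewrite -subr_eq0 -memv0 -(capv_compl K) memv_cap.
  apply/andP; split; last by rewrite memvB ?memvD ?memvZ.
  apply/KE.
  have -> : g (c *: x + y) - (c *: g x + g y) = (-1) *: (c *: g x + g y) + g (c *: x + y).
    by rewrite scaleN1r addrC.
  by rewrite !(act_linear HM) !gE scaleN1r addNr.
have lc i : linear ((fun x => coord (vbasis fullv) i (g x)) : M -> k^o).
  by move=> c x y; rewrite gl linearP.
exists [seq (act M (vbasis fullv)`_i m0, dual_of_linear (lc i)) | i : 'I_(\dim (@fullv k H))].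
move=> x; rewrite big_image /= -[RHS]gE.
rewrite {2}(coord_vbasis (memvf (g x))) (linear_bigop _ _ (act_linear HM m0)).
by apply: eq_bigr => i _; rewrite (linear_scale _ _ (act_linear HM m0)).
Qed.

End SimpleModules.

(** * Schur's lemma and subspaces of W ⊗ M *)

Lemma count_lt (T : eqType) (a b : pred T) (s : seq T) (x : T) :
  subpred a b -> x \in s -> b x -> ~~ a x -> (count a s < count b s)%N.
Proof.
move=> ab + bx /negPf ax; elim: s => [//|y s IH] /=; rewrite inE => /orP [/eqP <-|xs].
  by rewrite bx ax add0n add1n ltnS sub_count.
by rewrite -addnS leq_add ?IH //; case: (a y) (ab y) => // ->.
Qed.

Section Schur.
Variables (k : closedFieldType) (H : falgType k).

(** The dim H + 1 first powers of a are linearly dependent. *)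
Lemma annihilating_poly (a : H) : exists2 p : {poly k}, p != 0 & horner_alg a p = 0.
Proof.
pose n := \dim (@fullv k H); pose X := [tuple a ^+ (i : nat) | i < n.+1].
have nf : ~ free X.
  rewrite /free eq_sym => /eqP e; have := dimvS (subvf <<X>>).
  by rewrite -e size_tuple ltnn.
have [c /not_implyP [ec /existsNP [i /eqP ci]]] : exists c : 'I_n.+1 -> k,
    ~ (\sum_(i < n.+1) c i *: X`_i = 0 -> forall i, c i = 0).
  by apply/existsNP => e; apply: nf; apply/freeP.
exists (\poly_(i < n.+1) c (inord i)).
  apply: contraNneq ci => /(congr1 (fun p : {poly k} => p`_i)).
  by rewrite coef_poly coef0 ltn_ord inord_val => ->.
rewrite poly_def rmorph_sum /= -[RHS]ec; apply: eq_bigr => j _.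
rewrite inord_val linearZ /= rmorphXn /= horner_algX.
by rewrite mulr_algl /X nth_mktuple.
Qed.

(** The hypothesis says that h w0 |-> h w1 defines an endomorphism of W.  With
    w1 = a w0 it maps h w0 to h a w0, so it is annihilated by any polynomial that
    annihilates a; some linear factor X - r of such a polynomial has a nonzero kernel,
    which is a submodule, hence all of W. *)
Lemma schur_scalar (W : module_data H) (w0 w1 : W) : simple_module W -> w0 <> 0 ->
  (forall h, act W h w0 = 0 -> act W h w1 = 0) -> exists c, w1 = c *: w0.
Proof.
move=> sW w0N ann; have [HW _ Wmin] := sW.
have [a ea] := simple_cyclic w1 sW w0N.
have [p p0 pa] := annihilating_poly a.
have [rs ers] := closed_field_poly_normal p.
have : act W (horner_alg a (\prod_(r <- rs) ('X - r%:P))) w0 = 0.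
  have lc0 : lead_coef p != 0 by rewrite lead_coef_eq0.
  have -> : \prod_(r <- rs) ('X - r%:P) = (lead_coef p)^-1 *: p.
    by rewrite {2}ers scalerA mulVf // scale1r.
  by rewrite linearZ /= pa mulr0 act0.
elim: rs {ers} => [|r rs IH]; first by rewrite big_nil rmorph1 (act1 HW).
rewrite big_cons; set Q := \prod_(r <- rs) _ in IH *; rewrite mulrC rmorphM /= (actM HW).
set q := horner_alg a Q in IH *.
pose y := w1 - r *: w0.
have -> : act W (horner_alg a ('X - r%:P)) w0 = y.
  rewrite rmorphB /= horner_algX horner_algC.
  have -> : a - r%:A = (- r) *: 1 + a by rewrite scaleNr addrC.
  by rewrite (act_linear HW) (act1 HW) ea scaleNr addrC.
move=> qy; have [/IH //|x0] := pselect (act W q w0 = 0).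
pose Y : {pred W} := fun v => `[< exists2 h, act W h w0 = v & act W h y = 0 >].
have Yst : stable Y.
  split; first split.
  - by apply/asboolP; exists 0; rewrite act0.
  - move=> c u v /asboolP [g <- gy] /asboolP [h <- hy]; apply/asboolP; exists (c *: g + h).
      by rewrite (act_linear HW).
    by rewrite (act_linear HW) gy hy scaler0 addr0.
  move=> g u /asboolP [h <- hy]; apply/asboolP; exists (g * h); rewrite (actM HW) //.
  by rewrite hy linear0.
case: (Wmin Y Yst) => [Y0|Yall].
  by case: x0; apply: Y0; apply/asboolP; exists q.
have /asboolP [h hw hy] := Yall w0.
have h1 (v : W) : act W (h - 1) v = act W h v - v.
  have -> : h - 1 = (-1) *: 1 + h by rewrite scaleN1r addrC.
  by rewrite (act_linear HW) (act1 HW) scaleN1r addrC.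
have e1 : act W (h - 1) w1 = 0 by apply: ann; rewrite h1 hw subrr.
exists r; apply/eqP; rewrite -subr_eq0; apply/eqP.
have : act W (h - 1) y = 0 by rewrite linearB linearZ /= e1 h1 hw subrr scaler0 subr0.
by rewrite h1 hy sub0r => /eqP; rewrite oppr_eq0 => /eqP.
Qed.

End Schur.

Section TensorSub.
Variables (k : closedFieldType) (H : falgType k).
Variables W M : module_data H.
Hypotheses (sW : simple_module W) (sM : simple_module M).
Let HW : is_module W := let: And3 h _ _ := sW in h.
Let HM : is_module M := let: And3 h _ _ := sM in h.

Definition coord_at (p : dual M) (t : (W ⊗ M)%type) : W := \tsum_(w, m <- t) ((p m : k) *: w).

Lemma coord_at_linear p : linear (coord_at p).
Proof. by rewrite /coord_at; lin. Qed.

Lemma coord_at_pure p w m : coord_at p (w ⊗ m) = (p m : k) *: w.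
Proof. by rewrite /coord_at tlift_pure //; lin. Qed.

Lemma coord_at_act p h t : coord_at p (outer_act (h ⊗ 1) t) = act W h (coord_at p t).
Proof.
have lc := coord_at_linear p; have lt := outer_act_linear (h ⊗ 1).
move: t; apply: tensor_linear_ext => [||w m]; [lin|lin|].
by rewrite outer_act_pure2 // !coord_at_pure (act1 HM) linearZ.
Qed.

Lemma pure_neq0 (w : W) (m : M) : w <> 0 -> m <> 0 -> w ⊗ m <> 0.
Proof.
move=> w0 m0 e; have [s sE] := simple_frame sM; apply: m0; rewrite -(sE m).
apply: big1 => i _; suff -> : (i.2 m : k) = 0 by rewrite scale0r.
have := congr1 (coord_at i.2) e; rewrite coord_at_pure.
have -> : coord_at i.2 0 = 0 by exact: (linear_zero (coord_at_linear i.2)).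
by move/eqP; rewrite scaler_eq0 => /orP [/eqP //|/eqP].
Qed.

Lemma frame_expand (s : seq (M * dual M)) t :
  (forall x, \sum_(i <- s) (i.2 x : k) *: i.1 = x) ->
  t = \sum_(i <- s) coord_at i.2 t ⊗ i.1.
Proof.
move=> sE; move: t; apply: tensor_linear_ext => [//||w m].
  move=> c u v; rewrite scaler_sumr -big_split; apply: eq_bigr => i _ /=.
  by rewrite coord_at_linear pure_linearl.
rewrite -{1}[m]sE (linear_bigop _ _ (pure_linearr w)); apply: eq_bigr => i _.
rewrite coord_at_pure (linear_scale _ _ (pure_linearr w)).
by rewrite (linear_scale _ _ (pure_linearl i.1)).
Qed.

(** Take t in U with as few nonzero coordinates in M as possible.  An element of H
    that kills one nonzero coordinate w0 of t shortens t, hence kills t and all its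
    coordinates; by Schur's lemma all coordinates are multiples of w0, so
    t = w0 ⊗ m. *)
Lemma tensor_submodule_slice (U : {pred (W ⊗ M)%type}) (t : (W ⊗ M)%type) :
  submod_closed U -> (forall h u, u \in U -> outer_act (h ⊗ 1) u \in U) ->
  t \in U -> t <> 0 -> exists2 m : M, m <> 0 & forall w : W, w ⊗ m \in U.
Proof.
move=> [U0 UD] Uh; have [s sE] := simple_frame sM.
have [n] := ubnP (count (fun i => coord_at i.2 t != 0) s).
elim: n t => // n IH t; rewrite ltnS => le_n tU t0.
have [[h hlt h0]|noh] := pselect (exists2 h,
    (count (fun i => coord_at i.2 (outer_act (h ⊗ 1) t) != 0%R) s
       < count (fun i => coord_at i.2 t != 0%R) s)%N & outer_act (h ⊗ 1) t <> 0).
  by apply: (IH (outer_act (h ⊗ 1) t)) => //; [exact: leq_trans hlt le_n | exact: Uh].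
have [i0 i0s wN] : exists2 i0, i0 \in s & coord_at i0.2 t != 0.
  apply: contrapT => no; apply: t0; rewrite (frame_expand t sE) big_seq big1 // => i si.
  have -> : coord_at i.2 t = 0 by apply: contrapT => /eqP ne; apply: no; exists i.
  exact: (linear_zero (pure_linearl (V := W) i.1)).
set w0 := coord_at i0.2 t in wN.
have ann h : act W h w0 = 0 -> outer_act (h ⊗ 1) t = 0.
  move=> hw0; apply: contrapT => ne; apply: noh; exists h => //.
  apply: (@count_lt _ _ _ _ i0) => //=; last by rewrite coord_at_act hw0 eqxx.
  by move=> i /=; rewrite coord_at_act; apply: contra => /eqP ->; rewrite linear0.
have sc (i : M * dual M) : exists c, coord_at i.2 t = c *: w0.
  apply: schur_scalar => //; first exact/eqP.
  move=> h /ann e; rewrite -coord_at_act e.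
  exact: (linear_zero (coord_at_linear i.2)).
pose c i := projT1 (cid (sc i)).
have cE i : coord_at i.2 t = c i *: w0 := projT2 (cid (sc i)).
have te : t = w0 ⊗ (\sum_(i <- s) c i *: i.1).
  rewrite {1}(frame_expand t sE) (linear_bigop _ _ (pure_linearr w0)); apply: eq_bigr => i _.
  rewrite cE (linear_scale _ _ (pure_linearr w0)).
  by rewrite (linear_scale _ _ (pure_linearl i.1)).
exists (\sum_(i <- s) c i *: i.1).
  move=> m0; apply: t0; rewrite te m0.
  exact: (linear_zero (pure_linearr (W := M) w0)).
move=> w; have [h <-] := simple_cyclic w sW (elimN eqP wN).
by have := Uh h t tU; rewrite te outer_act_pure2 // (act1 HM).
Qed.

End TensorSub.

(** * Irreducibility and isomorphisms *)

Section LinearMaps.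
Variable k : fieldType.

Lemma submod_sum (V : lmodType k) (U : {pred V}) (T : eqType) (s : seq T) (F : T -> V) :
  submod_closed U -> (forall i, i \in s -> F i \in U) -> \sum_(i <- s) F i \in U.
Proof.
case=> U0 UD; elim: s => [|i s IH] sU; first by rewrite big_nil.
rewrite big_cons -[F i]scale1r UD ?sU ?mem_head //.
by apply: IH => j js; rewrite sU // inE js orbT.
Qed.

Lemma inj_surj_bij (V W : lmodType k) (f : V -> W) :
  linear f -> (forall x, f x = 0 -> x = 0) -> (forall y, exists x, f x = y) -> bijective f.
Proof.
move=> lf f0 fs; pose g y := projT1 (cid (fs y)).
have gK y : f (g y) = y := projT2 (cid (fs y)).
exists g => // x; apply/eqP; rewrite -subr_eq0; apply/eqP/f0.
have -> : g (f x) - x = (-1) *: x + g (f x) by rewrite scaleN1r addrC.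
by rewrite lf gK scaleN1r addNr.
Qed.
End LinearMaps.

Section Objects.
Variables (k : closedFieldType) (H : falgType k) (A : hopf_algebra H) (R : (H ⊗ H)%type).
Hypotheses (HR : quasi_triangular A R) (Hfact : factorizable R).
Local Notation Δ := (coprod A).
Local Notation hh_act := (hh_act HR Hfact).
Local Notation e_ i := ((vbasis (@fullv k H))`_i).

(** The operator attached to it extracts the i-th coordinate of the coaction. *)
Definition coord_end (i : 'I_(\dim (@fullv k H))) : 'End(H) :=
  linfun (fun x : H => coord (vbasis fullv) i x *: (1 : H)).

Lemma coord_endE i x : coord_end i x = coord (vbasis fullv) i x *: 1.
Proof.
apply: linfun_linear => c a b.
by rewrite linearP scalerDl scalerA.
Qed.

Lemma coact_expand (V : yd_data H) (v : V) : is_yd A V ->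
  coact v = \sum_(i < \dim (@fullv k H)) e_ i ⊗ end_act (coord_end i) v.
Proof.
move=> HV; have Vm := yd_module HV.
rewrite -{1}[coact v]tlift_id [LHS]/tlift /formal_sum.
under [RHS]eq_bigr => i _.
  rewrite /end_act (tlift_push _ _ (pure_linearr _)) /tlift /formal_sum; over.
rewrite [RHS]exchange_big; apply: eq_bigr => x _ /=.
rewrite {1}(coord_vbasis (memvf x.1)) (linear_bigop _ _ (pure_linearl x.2)).
apply: eq_bigr => i _; rewrite coord_endE.
rewrite (linear_scale _ _ (pure_linearl x.2)) (linear_scale _ _ (act_linear Vm x.2)).
by rewrite (act1 Vm) (linear_scale _ _ (pure_linearr _)).
Qed.

Lemma yd_submodule_end_act (V : yd_data H) (U : {pred V}) X u : is_yd A V ->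
  yd_submodule U -> u \in U -> end_act X u \in U.
Proof.
move=> HV [[Usub Uact] Uco] uU; have Vm := yd_module HV; have [s sU e] := Uco u uU.
have bl : bilinear_map (fun y (u : V) => act V (X y) u) by lin.
rewrite /end_act e (linear_bigop _ _ (tlift_linear bl)).
have Us : all (fun x : H * V => x.2 \in U) s by [].
elim: s {e sU} Us => [_|x s IH /= /andP [xU /IH sU]]; first by rewrite big_nil; case: Usub.
rewrite big_cons tlift_pure // -[act V _ _]scale1r; case: Usub => _; apply => //.
exact: Uact.
Qed.

Lemma hh_stable_yd_submodule (V : yd_data H) (U : {pred V}) : is_yd A V ->
  submod_closed U -> (forall t u, u \in U -> hh_act t u \in U) -> yd_submodule U.
Proof.
move=> HV Usub Ut; split; first split=> // h u uU.
  by rewrite -(hh_act_coprod HR Hfact HV); exact: Ut.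
move=> u uU; exists [seq (e_ i, end_act (coord_end i) u) | i : 'I_(\dim (@fullv k H))].
  apply/allP => x /imageP [i _ ->] /=; rewrite (end_actE HR Hfact); exact: Ut.
by rewrite big_image /= (coact_expand u HV).
Qed.

Lemma bar_irreducible W M : simple_module W -> simple_module M ->
  irreducible_yd A (bar_tensor A R W M).
Proof.
move=> sW sM; have [HW [w0 /eqP w0N] _] := sW; have [HM [m0 /eqP m0N] Mmin] := sM.
have HB := bar_is_yd HR HW HM.
split=> //; first by exists (w0 ⊗ m0); apply/eqP/pure_neq0.
move=> U Usub; have [[Ucl Uact] _] := Usub.
have Ut t u : u \in U -> outer_act (W := W) (M := M) t u \in U.
  by move=> uU; rewrite -(hh_act_bar HR Hfact HW HM); exact: (yd_submodule_end_act _ HB).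
have [all0|/existsNP [u /not_implyP [uU u0]]] := pselect (forall u, u \in U -> u = 0).
  by left.
right=> t.
have [m mN mU] := tensor_submodule_slice sW sM Ucl (fun h => Ut (h ⊗ 1)) uU u0.
have pU w m' : w ⊗ m' \in U.
  have [h <-] := simple_cyclic m' sM mN.
  by have := Ut (1 ⊗ h) _ (mU w); rewrite outer_act_pure2 // (act1 HW).
by rewrite -[t]tlift_id; apply: submod_sum.
Qed.

Definition yd_morphism (V W : yd_data H) (f : V -> W) : Prop :=
  [/\ linear f, forall h v, f (act V h v) = act W h (f v)
    & forall v, coact (f v) = \tsum_(x, u <- coact v) x ⊗ f u].

Lemma yd_iso_bij (V W : yd_data H) (f : V -> W) : yd_morphism f -> bijective f -> yd_iso V W.
Proof. by case=> lf fact fco bf; exists (bundle_linear lf). Qed.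

Lemma yd_iso_sym (V W : yd_data H) : yd_iso V W -> yd_iso W V.
Proof.
case=> f [[g fK gK] fact fco].
have lf : linear f by exact: linearP.
have lg : linear g := can2_linear fK gK.
apply: (@yd_iso_bij W V g); last by exists f.
split=> // [h w|w].
  by apply: (can_inj fK); rewrite fact !gK.
rewrite -{2}[w]gK fco tlift_tlift; last by lin.
rewrite -[LHS]tlift_id; apply: tlift_ext => x u.
by rewrite tlift_pure ?fK //; lin.
Qed.

Lemma yd_morphism_end_act (V W : yd_data H) (f : V -> W) X v : is_module W ->
  yd_morphism f -> f (end_act X v) = end_act X (f v).
Proof.
move=> HW [lf fact fco]; rewrite /end_act fco tlift_tlift; last by lin.
rewrite (tlift_push _ _ lf); apply: tlift_ext => y u.
by rewrite tlift_pure ?fact //; lin.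
Qed.

(** The operators attached to [counit_end] and [coord_end] give the action and the
    coaction. *)
Lemma end_act_yd_morphism (V W : yd_data H) (f : V -> W) : is_yd A V -> is_yd A W ->
  linear f -> (forall X v, f (end_act X v) = end_act X (f v)) -> yd_morphism f.
Proof.
move=> HV HW lf fd; split=> // [h v|v].
  by rewrite -(end_act_counit HV) fd (end_act_counit HW).
have bl : bilinear_map (fun x u => x ⊗ f u : (H ⊗ W)%type) by lin.
rewrite (coact_expand _ HW) (coact_expand v HV) (linear_bigop _ _ (tlift_linear bl)).
by apply: eq_bigr => i _; rewrite tlift_pure // fd.
Qed.

Lemma hh_act_pure (V : yd_data H) (v : V) x y : is_yd A V ->
  hh_act (x ⊗ y) v = hh_act (x ⊗ 1) (hh_act (1 ⊗ y) v).
Proof.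
move=> HV; rewrite -(hh_actM HR Hfact HV) /tmul tlift_pure; last by lin.
by rewrite tlift_pure ?mul1r ?mulr1 //; lin.
Qed.

(** B induces a morphism of H ⊗ H-modules between two irreducible objects; its kernel
    and its image are subobjects. *)
Lemma yd_iso_of_bilinear (V : yd_data H) (W M : module_data H) (B : W -> M -> V) :
  irreducible_yd A V -> simple_module W -> simple_module M -> bilinear_map B ->
  (forall h w m, B (act W h w) m = hh_act (h ⊗ 1) (B w m)) ->
  (forall h w m, B w (act M h m) = hh_act (1 ⊗ h) (B w m)) ->
  (exists w m, B w m <> 0) -> yd_iso V (bar_tensor A R W M).
Proof.
move=> [HV _ Vmin] sW sM bB Bl Br [w0 [m0 Bn0]].
have [HW _ _] := sW; have [HM _ _] := sM.
have HB := bar_is_yd HR HW HM; have [_ _ Bmin] := bar_irreducible sW sM.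
pose F : bar_tensor A R W M -> V := tlift B.
have lF : linear F := tlift_linear bB.
have F0 : F 0 = 0 by exact: (linear_zero lF).
have Ft t u : F (hh_act t u) = hh_act t (F u).
  rewrite (hh_act_bar HR Hfact HW HM).
  have lt := fun v : V => hh_act_linearl HR Hfact HV v.
  have ltr := fun t => hh_act_linearr HR Hfact HV t.
  have lh := outer_act_linear (W := W) (M := M).
  have lhl u := @outer_act_linearl k H W M u HW HM.
  move: u; apply: tensor_linear_ext => [||w m].
  - exact: (@comp_linear _ _ _ _ F (outer_act t) lF (lh t)).
  - exact: (@comp_linear _ _ _ _ (hh_act t) F (ltr t) lF).
  move: t; apply: tensor_linear_ext => [||x y].
  - exact: (@comp_linear _ _ _ _ F (fun t => outer_act t (w ⊗ m)) lF (lhl _)).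
  - exact: lt.
  rewrite outer_act_pure2 // hh_act_pure // /F !tlift_pure // Bl Br //.
have mF : yd_morphism F.
  by apply: end_act_yd_morphism => // X u; rewrite !(end_actE HR Hfact).
apply: yd_iso_sym; apply: (yd_iso_bij mF); apply: inj_surj_bij => // [u Fu|v].
  pose U : {pred bar_tensor A R W M} := fun u => `[< F u = 0 >].
  have Usub : yd_submodule U.
    apply: hh_stable_yd_submodule => //.
      split=> [|c a b /asboolP Fx /asboolP Fy]; apply/asboolP => //.
      by rewrite lF Fx Fy scaler0 addr0.
    move=> t a /asboolP Fx; apply/asboolP; rewrite Ft Fx.
    exact: (linear_zero (hh_act_linearr HR Hfact HV t)).
  case: (Bmin U Usub) => [U0|Uall]; first by apply: U0; apply/asboolP.
  by case: Bn0; have /asboolP := Uall (w0 ⊗ m0); rewrite /F tlift_pure.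
pose U : {pred V} := fun v => `[< exists u, F u = v >].
have Usub : yd_submodule U.
  apply: hh_stable_yd_submodule => //.
    split=> [|c a b /asboolP [x Fx] /asboolP [y Fy]]; apply/asboolP; first by exists 0.
    by exists (c *: x + y); rewrite lF Fx Fy.
  by move=> t a /asboolP [x Fx]; apply/asboolP; exists (hh_act t x); rewrite Ft Fx.
case: (Vmin U Usub) => [U0|Uall]; last by have /asboolP := Uall v.
by case: Bn0; apply: U0; apply/asboolP; exists (w0 ⊗ m0); rewrite /F tlift_pure.
Qed.

End Objects.

(** * The dual of a simple module *)

Section Duality.
Variables (k : fieldType) (H : falgType k).

(** Induction on us: if f does not vanish on the common kernel of the tail us, at
    x say, then u x is nonzero, and f - (f x / u x) u vanishes on it. *)
Lemma common_kernel_mem (V : lmodType k) (U : {pred dual V}) (us : seq (dual V)) (f : dual V) :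
  submod_closed U -> {subset us <= U} ->
  (forall x, (forall u, u \in us -> u x = 0) -> f x = 0) -> f \in U.
Proof.
move=> [U0 UD]; elim: us f => [|u us IH] f sU ker.
  suff -> : f = 0 by [].
  by apply/val_inj/funext => x; exact: ker.
have usU : {subset us <= U} by move=> v vs; apply: sU; rewrite inE vs orbT.
have [all0|/existsNP [x /not_implyP [usx fx]]] :=
  pselect (forall x, (forall u, u \in us -> u x = 0) -> f x = 0); first exact: IH.
have ux : (u x : k) != 0.
  apply/eqP => ux; apply: fx; apply: ker => v; rewrite inE => /orP [/eqP -> //|].
  exact: usx.
pose c : k := f x / u x.
have f'U : f - c *: u \in U.
  apply: IH => // y usy.
  pose y0 := (- (u y / u x : k)) *: x + y.
  have y0E (v : dual V) : v y0 = - (u y / u x) * v x + v y :> k by exact: (dual_linear v).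
  have : f y0 = 0.
    apply: ker => v; rewrite inE => /orP [/eqP ->|vus]; rewrite [LHS]y0E.
      by rewrite mulNr divfK // addNr.
    by rewrite (usx v vus) (usy v vus) mulr0 addr0.
  rewrite y0E mulNr addrC => e; rewrite -[LHS]/((f y : k) - c * (u y : k)) -[RHS]e.
  by rewrite /c mulrAC [u y / u x * f x]mulrAC [u y * f x]mulrC.
have -> : f = c *: u + (f - c *: u) by rewrite addrC subrK.
by apply: UD => //; apply: sU; rewrite mem_head.
Qed.

(** Finitely many elements of U already separate the points of W: adding an element
    of U that does not vanish on their common kernel makes the kernel smaller, and
    W is a quotient of H. *)
Lemma separating_dual (W : module_data H) (U : {pred dual W}) : simple_module W ->
  submod_closed U -> (forall w, (forall u, u \in U -> u w = 0) -> w = 0) ->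
  forall f, f \in U.
Proof.
move=> sW Ucl sep f; have [HW [w0 /eqP w0N] _] := sW.
have kerK (us : seq (dual W)) : exists K : {vspace H},
    forall h, h \in K <-> forall u, u \in us -> u (act W h w0) = 0.
  apply: subspace_vspace => [u _|c g h eg eh u us_u].
    by rewrite act0 //; exact: (linear_zero (dual_linear u)).
  by rewrite (act_linear HW) (dual_linear u) eg // eh // scaler0 addr0.
suff [us usU us0] : exists2 us : seq (dual W), {subset us <= U} &
    forall w, (forall u, u \in us -> u w = 0) -> w = 0.
  apply: (common_kernel_mem Ucl usU) => w /us0 ->.
  exact: (linear_zero (dual_linear f)).
suff ext n (us : seq (dual W)) (K : {vspace H}) : (\dim K <= n)%N -> {subset us <= U} ->
   (forall h, h \in K <-> forall u, u \in us -> u (act W h w0) = 0) ->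
   exists2 us : seq (dual W), {subset us <= U} &
    forall w, (forall u, u \in us -> u w = 0) -> w = 0.
  by have [K KE] := kerK [::]; apply: (ext _ [::] K (leqnn _) _ KE).
elim: n us K => [|n IH] us K le_n usU KE;
  have [done_|/existsNP [h /not_implyP [hK hw]]] :=
    pselect (forall h, h \in K -> act W h w0 = 0).
- exists us => // w ew; have [h eh] := simple_cyclic w sW w0N.
  by rewrite -eh; apply: done_; apply/KE; rewrite eh.
- case: hw; move: le_n hK; rewrite leqn0 dimv_eq0 => /eqP ->.
  by rewrite memv0 => /eqP ->; rewrite act0.
- exists us => // w ew; have [h eh] := simple_cyclic w sW w0N.
  by rewrite -eh; apply: done_; apply/KE; rewrite eh.
have [u uU uh] : exists2 u, u \in U & u (act W h w0) <> 0.
  by apply: contrapT => no; apply: hw; apply: sep => u uU; apply: contrapT => uh;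
     apply: no; exists u.
have [K' K'E] := kerK (u :: us).
apply: (IH (u :: us) K') => //; last first.
  by move=> v; rewrite inE => /orP [/eqP -> //|]; exact: usU.
rewrite -ltnS; apply: leq_trans le_n.
have sK : (K' <= K)%VS.
  apply/subvP => g /K'E e; apply/KE => v vus; apply: e; by rewrite inE vus orbT.
rewrite ltn_neqAle dimvS // andbT; apply/eqP => e.
have eK : K' = K by apply/eqP; rewrite eqEdim sK e leqnn.
by apply: uh; move: hK; rewrite -eK => /K'E; apply; rewrite mem_head.
Qed.

End Duality.

Section DualSimple.
Variables (k : fieldType) (H : falgType k) (A : hopf_algebra H) (R : (H ⊗ H)%type).
Hypotheses (HR : quasi_triangular A R) (Hfact : factorizable R).
Local Notation Δ := (coprod A).
Local Notation S := (antipode A).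
Local Notation ε := (counit A).
Local Notation Si := (antipode_inv A).

(** A nonzero submodule of the dual separates points, because its annihilator in W is
    a proper submodule. *)
Lemma dual_module_simple (W : module_data H) : simple_module W -> simple_module (dual_module A W).
Proof.
move=> sW; have [HW [w0 /eqP w0N] Wmin] := sW.
split.
- split=> [f c g h|f|g h f]; apply/val_inj/funext => w /=.
  + rewrite (antipode_inv_linear A) (act_linear HW) (dual_linear f) //.
  + by rewrite (antipode_inv1 HR Hfact) (act1 HW).
  + by rewrite (antipode_invM HR Hfact) (actM HW).
- have [s sE] := simple_frame sW.
  apply: contrapT => no; apply: w0N; rewrite -(sE w0) big1 // => i _.
  have -> : i.2 = 0 by apply: contrapT => /eqP n0; apply: no; exists i.2.
  by rewrite [X in X *: _](_ : _ = 0) ?scale0r.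
move=> U [Ucl Uact].
have [all0|/existsNP [u /not_implyP [uU u0]]] := pselect (forall u, u \in U -> u = 0).
  by left.
right; apply: (separating_dual sW Ucl).
pose K : {pred W} := fun w => `[< forall u, u \in U -> (u : dual W) w = 0 >].
have Kst : stable K.
  split; first split.
  - apply/asboolP => v _; exact: (linear_zero (dual_linear v)).
  - move=> c w1 w2 /asboolP e1 /asboolP e2; apply/asboolP => v vU.
    by rewrite (dual_linear v) e1 // e2 // scaler0 addr0.
  move=> h w /asboolP e; apply/asboolP => v vU.
  by have := e _ (Uact (S h) v vU); rewrite /= (antipode_invK HR Hfact).
case: (Wmin K Kst) => [K0 w ew|Kall]; first by apply: K0; apply/asboolP.
case: u0; apply/val_inj/funext => w; have /asboolP e := Kall w; exact: e.
Qed.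

End DualSimple.

(** * Exhaustion of the irreducible objects *)

Section Classification.
Variables (k : closedFieldType) (H : falgType k) (A : hopf_algebra H) (R : (H ⊗ H)%type).
Hypotheses (HR : quasi_triangular A R) (Hfact : factorizable R) (Hss : semisimple H).
Variables (I : Type) (irr : I -> module_data H).
Hypothesis Hirr : is_Irr irr.
Local Notation Δ := (coprod A).
Local Notation S := (antipode A).
Local Notation ε := (counit A).
Local Notation Si := (antipode_inv A).
Local Notation hh_act := (hh_act HR Hfact).

Lemma module_iso_inv (V W : module_data H) : module_iso V W ->
  exists g : W -> V, [/\ linear g, bijective g & forall h w, g (act W h w) = act V h (g w)].
Proof.
case=> f [[g fK gK] fact]; exists g; split; first exact: (can2_linear fK gK).
  by exists f.
by move=> h w; apply: (can_inj fK); rewrite fact !gK.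
Qed.

Lemma irr_left_ideal (J : {vspace H}) : minimal_left_ideal J ->
  exists i, exists g : irr i -> H,
    [/\ linear g, forall h w, g (act (irr i) h w) = h * g w
      & forall j, j \in J -> exists w, g w = j].
Proof.
move=> Jm; have [Ji _ _] := Jm.
have [i /module_iso_inv [g [lg [f fK gK] gact]]] := Irr_all Hirr (ideal_module_simple Jm).
exists i, (fun w => vsval (g w)); split.
- by move=> c u v; rewrite lg linearP.
- by move=> h w; rewrite gact ideal_actE.
by move=> j jJ; exists (f (vsproj J j)); rewrite gK vsprojK.
Qed.

(** Semisimplicity is applied to h |-> (h ⊗ 1) v, which is nonzero at 1, and then to
    h |-> (j ⊗ h) v for an element j of the first ideal. *)
Lemma irreducible_yd_bar (V : yd_data H) : irreducible_yd A V ->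
  exists i j, yd_iso V (bar_tensor A R (irr i) (irr j)).
Proof.
move=> iV; have [HV [v /eqP v0] _] := iV.
have lt := hh_act_linearl HR Hfact HV v.
have lf1 : linear (fun h => hh_act (h ⊗ 1) v).
  by refine (@comp_linear _ _ _ _ (fun t => hh_act t v) (fun h => h ⊗ 1) lt _); lin.
have [|J Jm [j jJ fj]] := minimal_left_ideal_exists Hss (h := 1) lf1.
  by rewrite (hh_act1 HR Hfact HV).
have lf2 : linear (fun h => hh_act (j ⊗ h) v).
  by refine (@comp_linear _ _ _ _ (fun t => hh_act t v) (fun h => j ⊗ h) lt _); lin.
have [//|J' J'm [j' j'J fj']] := minimal_left_ideal_exists Hss (h := 1) lf2.
have [a [ga [la aact aJ]]] := irr_left_ideal Jm.
have [b [gb [lb bact bJ]]] := irr_left_ideal J'm.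
exists a, b; apply: (yd_iso_of_bilinear (HR := HR) (Hfact := Hfact) (W := irr a) (M := irr b)
   (B := fun w m => hh_act (ga w ⊗ gb m) v)) => //.
- exact: Irr_simple.
- exact: Irr_simple.
- apply: bilinear_mapI => x.
    by refine (@comp_linear _ _ _ _ (fun t => hh_act t v) _ lt _); lin.
  by refine (@comp_linear _ _ _ _ (fun t => hh_act t v) _ lt _); lin.
- move=> h w m; rewrite -(hh_actM HR Hfact HV) aact; congr (hh_act _ v).
  by rewrite /tmul !tlift_pure ?mul1r //; lin.
- move=> h w m; rewrite -(hh_actM HR Hfact HV) bact; congr (hh_act _ v).
  by rewrite /tmul !tlift_pure ?mul1r //; lin.
by have [w ew] := aJ j jJ; have [m em] := bJ j' j'J; exists w, m; rewrite ew em.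
Qed.

End Classification.

(** * Irreducible subobjects of H *)

Section Regular.
Variables (k : closedFieldType) (H : falgType k) (A : hopf_algebra H) (R : (H ⊗ H)%type).
Hypotheses (HR : quasi_triangular A R) (Hfact : factorizable R).
Local Notation Δ := (coprod A).
Local Notation S := (antipode A).
Local Notation ε := (counit A).
Local Notation Si := (antipode_inv A).

Variable D : {vspace H}.
Hypothesis Dsub : @yd_submodule k H (yd_regular A) (fun h => h \in D).
Hypothesis Dirr : irreducible_yd A (yd_sub A D).
Local Notation V := (yd_sub A D).

Lemma counit_adjoint h x : ε (adjoint A h x) = (ε h : k) *: ε x.
Proof.
have lε : linear (fun b : H => (ε b : k) *: (ε x : k^o)) by lin.
rewrite /adjoint (tlift_push (g := ε : H -> k^o) _ _ (linearP _)) -[RHS](counitl_app A h lε).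
apply: tlift_ext => a b; rewrite !counitM counit_antipode -[LHS]mulrA.
by congr (_ * _); exact: mulrC.
Qed.

Lemma vsval_act h (d : V) : vsval (act V h d) = adjoint A h (vsval d).
Proof. by rewrite /= vsprojK //; case: Dsub => -[_ st] _; apply: (st h); exact: subvsP. Qed.

Lemma counit_vsval_linear : linear (fun d : subvs_of D => ε (vsval d) : k^o).
Proof. by move=> c x y; rewrite !linearP. Qed.

(** The identity d = d_(1) ε(d_(2)), in D. *)
Lemma coact_counit_right (d : V) :
  \tsum_(x, u <- coact d) ((ε (vsval u) : k) *: x) = vsval d.
Proof.
have lv := counit_vsval_linear.
have [_ /(_ (vsval d) (subvsP d)) [s sD e]] := Dsub.
rewrite /= in e sD *.
rewrite tlift_tlift; last by lin.
rewrite -[RHS](counitr A) e.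
have bl1 : bilinear_map (fun a b : H => (ε b : k) *: a) by lin.
have bl2 : bilinear_map (fun a b : H =>
  \tsum_(x, u <- a ⊗ vsproj D b) ((ε (vsval u) : k) *: x)) by lin.
rewrite !(linear_bigop _ _ (tlift_linear _)) //.
rewrite !big_seq; apply: eq_bigr => x xs; rewrite !tlift_pure //; last by lin.
by rewrite vsprojK //; exact: (allP sD).
Qed.

Section Iso.
Variables W M : module_data H.
Hypotheses (sW : simple_module W) (sM : simple_module M).
Variable F : {linear bar_tensor A R W M -> V}.
Hypothesis Fbij : bijective F.
Hypothesis F_act : forall h v, F (act _ h v) = act V h (F v).
Hypothesis Fco : forall v, coact (F v) = \tsum_(x, u <- coact v) x ⊗ F u.

Let HW : is_module W := let: And3 h _ _ := sW in h.
Let HM : is_module M := let: And3 h _ _ := sM in h.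

Definition counit_form (t : (W ⊗ M)%type) : k^o := ε (vsval (F t)).

Lemma counit_form_linear : linear counit_form.
Proof. by move=> c x y; rewrite /counit_form !linearP. Qed.

Lemma counit_form_act h t : counit_form (tensor_act A h t) = (ε h : k) *: counit_form t.
Proof. by rewrite /counit_form -counit_adjoint -vsval_act -F_act. Qed.

Lemma form_right_linear (w : W) : linear (fun m : M => counit_form (w ⊗ m)).
Proof.
exact: (@comp_linear _ _ _ _ counit_form (fun m => w ⊗ m) counit_form_linear (pure_linearr _)).
Qed.
Lemma form_left_linear (m : M) : linear (fun w : W => counit_form (w ⊗ m)).
Proof.
exact: (@comp_linear _ _ _ _ counit_form (fun w => w ⊗ m) counit_form_linear (pure_linearl _)).
Qed.

Definition form_map (m : M) : dual W := dual_of_linear (form_left_linear m).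

Lemma form_map_linear : linear form_map.
Proof. by move=> c m m'; apply/val_inj/funext => w; exact: (form_right_linear w). Qed.

(** Apply id ⊗ ε to the coaction of F (w ⊗ m).  By invariance of the form the factors
    relating ρ_R to the Yetter-Drinfeld coaction disappear. *)
Lemma iso_coef_gen w m : vsval (F (w ⊗ m)) = coef_gen A R (form_map m) w.
Proof.
have lv := counit_vsval_linear; have lF := linearP F; have lf := counit_form_linear.
rewrite -coact_counit_right Fco tlift_tlift; last by lin.
transitivity (\tsum_(x, u <- @coact _ _ (bar_tensor A R W M) (w ⊗ m))
    ((counit_form u : k) *: x)).
  by apply: tlift_ext => x u; rewrite tlift_pure //; lin.
rewrite /= tlift_tlift; last by lin.
transitivity (\tsum_(x, u <- bar_coactR R (w ⊗ m : tensor_module A W M))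
    ((counit_form u : k) *: x)).
  apply: tlift_ext => x u; rewrite tlift_tlift; last by lin.
  transitivity (\tsum_(a, b <- R) ((ε a : k) *: ((counit_form u : k) *: (x * b)))).
    apply: tlift_ext => a b; rewrite tlift_pure; last by lin.
    by rewrite (counit_form_act a u) scalerA.
  by rewrite (R_counitl_app HR (F := fun b => (counit_form u : k) *: (x * b))) ?mulr1 //; lin.
rewrite /bar_coactR tlift_pure; last by lin.
rewrite tlift_tlift; last by lin.
apply: tlift_ext => a b; rewrite tlift_tlift; last by lin.
by apply: tlift_ext => c d; rewrite tlift_pure //; lin.
Qed.

(** As h2 S^{-1}(h1) = ε(h), an invariant form β satisfies
    β(w, h m) = β(h2 S^{-1}(h1) w, h3 m) = β(S^{-1}(h) w, m). *)
Lemma form_map_act h m : form_map (act M h m) = act (dual_module A W) h (form_map m).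
Proof.
apply/val_inj/funext => w /=.
have lf := counit_form_linear; have lSi := antipode_inv_linear A.
have lft : forall h, linear (fun w : W => counit_form (w ⊗ act M h m)).
  by move=> g; exact: form_left_linear.
transitivity (\tsum_(a1, x <- Δ h) \tsum_(a2, b <- Δ x)
     counit_form (act W (a2 * Si a1) w ⊗ act M b m)).
  rewrite -(coassoc A (F := fun a1 a2 b => counit_form (act W (a2 * Si a1) w ⊗ act M b m)));
    last by lin.
  rewrite -(counitl_app A (F := fun b => counit_form (w ⊗ act M b m))); last by lin.
  apply: tlift_ext => a b.
  rewrite (antipode_invr_app HR Hfact (F := fun z => counit_form (act W z w ⊗ act M b m)));
    last by lin.
  by rewrite (act1 HW).
rewrite -[RHS](counitr_app A (F := fun z => counit_form (act W (Si z) w ⊗ m))); last by lin.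
apply: tlift_ext => a1 x; rewrite -[RHS]counit_form_act tensor_act_pure.
rewrite (tlift_push _ _ lf); apply: tlift_ext => a2 b.
by rewrite (actM HW).
Qed.

(** It is a morphism of simple modules, and it is not zero: otherwise F would
    vanish, by [iso_coef_gen]. *)
Lemma form_map_bij : bijective form_map.
Proof.
have sD := dual_module_simple HR Hfact sW.
have [_ _ Dmin] := sD; have [_ _ Mmin] := sM.
have lt := form_map_linear.
have t0 : form_map 0 = 0 by exact: (linear_zero lt).
have [m0 tm0] : exists m, form_map m <> 0.
  apply: contrapT => no.
  have [_ [d /eqP d0] _] := Dirr; apply: d0.
  have [G GK KG] := Fbij; rewrite -(KG d).
  suff F0 t : F t = 0 by rewrite F0.
  move: t; apply: tensor_linear_ext => [||w m]; first exact: linearP.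
    by move=> c x y; rewrite scaler0 addr0.
  apply: subvs_inj; rewrite iso_coef_gen linear0.
  have -> : form_map m = 0 by apply: contrapT => ne; apply: no; exists m.
  rewrite /coef_gen /tlift /formal_sum big1 // => i _; rewrite big1 // => j _.
  by rewrite [X in X *: _](_ : _ = 0) ?scale0r.
apply: inj_surj_bij => //.
  pose U : {pred M} := fun m => `[< form_map m = 0 >].
  have Ust : stable U.
    split; first split.
    - exact/asboolP.
    - by move=> c x y /asboolP ex /asboolP ey; apply/asboolP; rewrite lt ex ey scaler0 addr0.
    by move=> h x /asboolP ex; apply/asboolP; rewrite form_map_act ex linear0.
  case: (Mmin U Ust) => [U0 m em|Uall]; first by apply: U0; apply/asboolP.
  by case: tm0; have /asboolP := Uall m0.
pose U : {pred dual_module A W} := fun f => `[< exists m, form_map m = f >].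
have Ust : stable U.
  split; first split.
  - by apply/asboolP; exists 0.
  - by move=> c x y /asboolP [m em] /asboolP [n en]; apply/asboolP; exists (c *: m + n);
       rewrite lt em en.
  by move=> h x /asboolP [m em]; apply/asboolP; exists (act M h m); rewrite form_map_act em.
case: (Dmin U Ust) => [U0|Uall] f; last by have /asboolP := Uall f.
by case: tm0; apply: U0; apply/asboolP; exists m0.
Qed.

End Iso.
End Regular.

Section Final.
Variables (k : closedFieldType) (H : falgType k) (A : hopf_algebra H) (R : (H ⊗ H)%type).
Hypotheses (HR : quasi_triangular A R) (Hfact : factorizable R).
Variable D : {vspace H}.
Hypothesis Dsub : @yd_submodule k H (yd_regular A) (fun h => h \in D).
Hypothesis Dirr : irreducible_yd A (yd_sub A D).
Local Notation V := (yd_sub A D).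

(** M is isomorphic to the dual of W through [form_map]. *)
Lemma yd_iso_bar_dual (W M : module_data H) : simple_module W -> simple_module M ->
  yd_iso V (bar_tensor A R W M) -> yd_iso V (bar_tensor A R W (dual_module A W)).
Proof.
move=> sW sM /yd_iso_sym [F [Fbij F_act Fco]].
have [HW [w0 /eqP w0N] _] := sW; have [HM [m0 /eqP m0N] _] := sM; have [HV _ _] := Dirr.
have mF : yd_morphism F by split=> //; exact: linearP.
have Ft t u : F (outer_act (W := W) (M := M) t u) = hh_act HR Hfact t (F u).
  by rewrite -(hh_act_bar HR Hfact HW HM) /hh_act (yd_morphism_end_act _ _ (yd_module HV) mF).
have lth := form_map_linear F.
have [psi thK psiK] := form_map_bij HR Hfact Dsub Dirr sW sM Fbij F_act Fco.
have lpsi : linear psi := can2_linear (f := bundle_linear lth) thK psiK.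
have psi_act h f : psi (act (dual_module A W) h f) = act M h (psi f).
  by apply: (can_inj thK); rewrite psiK (form_map_act HR Hfact Dsub sW sM F_act) psiK.
apply: (yd_iso_of_bilinear (HR := HR) (Hfact := Hfact) (W := W) (M := dual_module A W)
   (B := fun w f => F (w ⊗ psi f))) => //.
- exact: (dual_module_simple HR Hfact).
- lin.
- by move=> h w f; rewrite -Ft outer_act_pure2 // (act1 HM).
- by move=> h w f; rewrite -Ft outer_act_pure2 // (act1 HW) psi_act.
exists w0, (form_map F m0); rewrite thK => e.
apply: (pure_neq0 sM w0N m0N); apply: (bij_inj Fbij); rewrite e.
by rewrite linear0.
Qed.

Lemma coef_spaceE (W : module_data H) : simple_module W ->
  yd_iso V (bar_tensor A R W (dual_module A W)) ->
  forall h, h \in D <-> coef_space A R W h.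
Proof.
move=> sW /yd_iso_sym [F [Fbij F_act Fco]] h; have sD := dual_module_simple HR Hfact sW.
have FE := iso_coef_gen HR Dsub F_act Fco.
have [psi thK psiK] := form_map_bij HR Hfact Dsub Dirr sW sD Fbij F_act Fco.
have [G GK KG] := Fbij; split=> [hD|[s]].
  pose t := G (vsproj D h); exists [seq (form_map F x.2, x.1) | x <- repr t].
  have -> : h = vsval (F t) by rewrite KG vsprojK.
  rewrite -[t in F t]tlift_id (tlift_push _ _ (linearP F)).
  rewrite (tlift_push (g := @vsval _ _ D) _ _ (linearP _)) -map_comp.
  rewrite /tlift /formal_sum big_seq; apply: memv_suml => x xs /=.
  by rewrite FE; apply: memv_span; apply/mapP; exists x.
move: h; apply/subvP/span_subvP => _ /mapP [x _ ->].
by rewrite -[x.1]psiK -FE subvsP.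
Qed.

End Final.

Theorem theorem12 (k : closedFieldType) (H : falgType k) (A : hopf_algebra H)
    (R : (H ⊗ H)%type)
    (HR : quasi_triangular A R) (Hfact : factorizable R) (Hss : semisimple H)
    (I : Type) (irr : I -> module_data H) (Hirr : is_Irr irr) :
  [/\ (forall W M : module_data H,
         simple_module W -> simple_module M ->
         irreducible_yd A (bar_tensor A R W M)),
      (forall V : yd_data H, irreducible_yd A V ->
         exists i j, yd_iso V (bar_tensor A R (irr i) (irr j)))
    & (forall D : {vspace H},
         @yd_submodule k H (yd_regular A) (fun h => h \in D) ->
         irreducible_yd A (yd_sub A D) ->
         (exists i,
            yd_iso (yd_sub A D)
              (bar_tensor A R (irr i) (dual_module A (irr i)))) /\
         (forall i,
            yd_iso (yd_sub A D)
              (bar_tensor A R (irr i) (dual_module A (irr i))) ->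
            forall h : H, h \in D <-> coef_space A R (irr i) h))].
Proof.
have sI := Irr_simple Hirr.
split=> [W M sW sM|V iV|D Dsub Dirr].
- exact: bar_irreducible HR Hfact _ _ sW sM.
- exact: irreducible_yd_bar HR Hfact Hss _ _ Hirr V iV.
split=> [|i]; last exact: coef_spaceE HR Hfact _ Dsub Dirr _ (sI i).
have [i [j e]] := irreducible_yd_bar HR Hfact Hss Hirr Dirr.
by exists i; apply: yd_iso_bar_dual e.
Qed.
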